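(* Let $n\ge2$ and let $F_1,\dots,F_{(n-1)!}$ be the fundamental sequences (of order $n$), of which there are exactly $(n-1)!$, listed by increasing length and lexicographically within the same length. For a fundamental sequence $F$ let $f_F(k)$ be the number of order-$n$ ribbon tilings of the fundamental region $R_F(k)$, and let $\mathbf f(N)$ be the column vector of dimension $n!$ with components $f_{F_i}(N-j)$, $1\le i\le (n-1)!$, $0\le j\le n-1$, ordered first by increasing $j$ and then by increasing $i$. Then there is an $n!\times n!$ matrix $A_n$ (independent of $N$) such that $$\mathbf f(N)=A_n\,\mathbf f(N-1)$$ for all sufficiently large $N$, and such that: (1) every entry of $A_n$ is $0$, $1$ or $-1$; (2) $A_n$ has the block form $$A_n=\begin{bmatrix}A_n' & I_2\\ I_1 & 0\end{bmatrix},$$ where $A_n'$ has dimension $(n-1)!\times (n-1)(n-1)!$, $I_1$ is the identity matrix of dimension $(n-1)(n-1)!\times(n-1)(n-1)!$, and $I_2$ is the identity matrix of dimension $(n-1)!\times(n-1)!$.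
   Context: Ribbon tilings. The unit square $[x,x+1]\times[y,y+1]$ ($x,y\in\mathbb Z$) has level $x+y$. An order-$n$ ribbon tile is a set of $n$ unit squares forming a sequence in which each square after the first is immediately above or immediately to the right of its predecessor; the level of the tile is the lowest level of its squares. A ribbon tiling of a region is a covering by non-overlapping ribbon tiles contained in it. The strip of length $N$ is $R=[0,N]\times[0,n]$. Known: every tiling of $R$ has exactly one tile of each level $0,1,\dots,N-1$; tiles are labelled by their levels. Left-of relation. For distinct squares, $s_{x,y}\prec s_{x',y'}$ if either $x+y=x'+y'$ and $x<x'$, or $|(x+y)-(x'+y')|=1$, $x\le x'$ and $y\ge y'$. For distinct tiles $t_1,t_2$ of a tiling, $t_1\prec t_2$ if some square of $t_1$ is $\prec$ some square of $t_2$. Let $G_R$ be the graph with vertices $0,\dots,N-1$ and an edge between distinct $i,j$ iff $|i-j|\le n$. A tiling orients each edge as $i\to j$ when tile $i\prec$ tile $j$. Known: this gives a bijection between tilings of $R$ and acyclic orientations of $G_R$ in which $i\to i+n$ for all $i$. Tiling sequences. The tiling sequence of a tiling is the ordering of $0,\dots,N-1$ obtained by repeatedly choosing, among the not yet chosen labels, the smallest label that is a source of the oriented graph restricted to the not yet chosen labels. An initial segment is a sequence consisting of the first $k$ terms ($0\le k\le N$) of some tiling sequence of $R$. If $J$ is an initial segment, the tiles with labels in $J$ occupy the same squares in every tiling whose tiling sequence begins with $J$; the residual region $R_J$ is the part of $R$ not covered by these tiles. For $k\ge0$ (large enough to make sense), $R_J(k)$ denotes the residual region of $J$ in the strip of length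 $k+|J|$; it is covered by $k$ tiles. Fundamental sequences. For a sequence containing $0$ exactly once, $\zeta_0$ moves $0$ to the front. For $J=[0,j_1,\dots,j_k]$, $\delta(J)=[j_1-1,\dots,j_k-1]$. Let $J$ be an initial segment (in a strip of any length) whose last element is $0$, and let $d$ be the number of columns $[x,x+1]\times[0,n]$ completely covered by the tiles of $J$ (these are the first $d$ columns, and $0,\dots,d-1\in J$). Then $\phi(J)$ is the sequence $(\delta\circ\zeta_0)^d(J)$ rearranged in increasing order. A fundamental sequence is any sequence of the form $\phi(J)$ for such $J$; the empty sequence is one of them. Every fundamental sequence $F$ is itself an initial segment, and $R_F(k)$ is called a fundamental region; for $F$ empty, $R_F(k)$ is the strip of length $k$. *)

(* Defs.v *)
From mathcomp Require Import all_boot all_order all_algebra.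

Set Implicit Arguments.
Unset Strict Implicit.
Unset Printing Implicit Defensive.

Local Open Scope nat_scope.

(* The strip [0,N] x [0,n]: (x, y) stands for [x,x+1] x [y,y+1].  All regions
   considered are subsets of a strip, hence finite sets of its squares. *)
Definition square (n N : nat) : finType := ('I_N * 'I_n)%type.

Section Tilings.

Variables n N : nat.
Implicit Types (s : square n N) (t R : {set square n N}).
Implicit Types (P : {set {set square n N}}) (J : seq nat).

Definition level s : nat := s.1 + s.2.

Definition ribbon_step : rel (square n N) := fun s s' =>
  ((s'.1 == s.1 :> nat) && (s'.2 == s.2.+1 :> nat))
  || ((s'.1 == s.1.+1 :> nat) && (s'.2 == s.2 :> nat)).

Definition ribbon_tile t : bool :=
  [exists w : n.-tuple (square n N), sorted ribbon_step w && (t == [set:: w])].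

(* The bound N + n exceeds every level in the strip, so this is the minimum
   level whenever t is nonempty. *)
Definition tile_level t : nat := \big[minn/N + n]_(s in t) level s.

Definition ribbon_tiling R P : bool :=
  partition P R && [forall t in P, ribbon_tile t].

Definition square_left : rel (square n N) := fun s s' =>
  ((level s == level s') && (s.1 < s'.1))
  || (((level s == (level s').+1) || (level s' == (level s).+1))
      && (s.1 <= s'.1) && (s'.2 <= s.2)).

Definition tile_left : rel {set square n N} := fun t t' =>
  (t != t') && [exists s in t, exists s' in t', square_left s s'].

(* Edges of G_R: distinct labels with |i - j| <= n. *)
Definition label_edge : rel nat := fun i j =>
  [&& i != j, i <= j + n & j <= i + n].

(* The orientation of G_R by P; a label stands for the tile of that level. *)
Definition label_arrow P : rel nat := fun i j =>
  label_edge i j &&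
  [exists t in P, exists t' in P,
     [&& tile_level t == i, tile_level t' == j & tile_left t t']].

Definition sources P (c : seq nat) : seq nat :=
  [seq i <- iota 0 N | (i \notin c) &&
     ~~ has (fun j => (j \notin c) && label_arrow P j i) (iota 0 N)].

(* [sources] is increasing, so [take 1] selects its smallest element; it is
   nonempty as long as labels remain, the orientation being acyclic. *)
Definition tiling_sequence P : seq nat :=
  iter N (fun c => c ++ take 1 (sources P c)) [::].

Definition begins_with J P : bool :=
  ribbon_tiling [set: square n N] P && prefix J (tiling_sequence P).

Definition initial_segment J : Prop := exists P, begins_with J P.

Definition covered_by J P : {set square n N} :=
  \bigcup_(t in P | tile_level t \in J) t.

(* For an initial segment J the region does not depend on the tiling picked;
   the value for other sequences is a dummy. *)
Definition residual_region J : {set square n N} :=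
  if [pick P | begins_with J P] is Some P then ~: covered_by J P else set0.

Definition full_columns J : nat :=
  #|[set x : 'I_N | [forall y : 'I_n, (x, y) \notin residual_region J]]|.

End Tilings.

Definition zeta0 (J : seq nat) : seq nat := 0 :: rem 0 J.

Definition delta (J : seq nat) : seq nat := map predn (behead J).

(* N is the length of a strip in which J is an initial segment; it only serves
   to compute the number of fully covered columns. *)
Definition phi (n N : nat) (J : seq nat) : seq nat :=
  sort leq (iter (full_columns n N J) (fun K => delta (zeta0 K)) J).

Definition fundamental (n : nat) (F : seq nat) : Prop :=
  exists (N : nat) (J : seq nat),
    initial_segment n N (rcons J 0) /\ F = phi n N (rcons J 0).

(* f_F(k): here R_F(k) lies in the strip of length k + |F|. *)
Definition num_tilings (n : nat) (F : seq nat) (k : nat) : nat :=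
  #|[set P | ribbon_tiling (residual_region n (k + size F) F) P]|.

Definition length_lex_lt : rel (seq nat) := fun F G =>
  (size F < size G) || ((size F == size G) && Order.lt (F : seqlexi nat) G).

(* Position p = j (n-1)! + i holds f_{F_i}(N - j), with i, j counted from 0;
   so j <= n - 1. *)
Definition f_vec (n : nat) (Fs : seq (seq nat)) (N : nat) : 'cV[int]_(n`!) :=
  \col_(p < n`!)
     Posz (num_tilings n (nth [::] Fs (p %% n.-1`!)) (N - p %/ n.-1`!)).

Lemma fact_row_split n : 1 < n -> n.-1`! + n.-1 * n.-1`! = n`!.
Proof. by case: n => // n _; rewrite factS mulSn. Qed.

Lemma fact_col_split n : 1 < n -> n.-1 * n.-1`! + n.-1`! = n`!.
Proof. by move=> n_gt1; rewrite addnC fact_row_split. Qed.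

(* Main.v *)
Require Import Defs.
From mathcomp Require Import all_boot all_order all_algebra.
From mathcomp Require Import zify.

(* Let S be the set of labels removed so far, closed under i + n |-> i.  At level
   L the removed tiles cover the leftmost squares, and exactly as many as S
   dictates, so the residual region is {(x, y) | y < width S (x + y)} and
   depends on S only.  A tile whose squares are all leftmost is a source; its
   label is minimal in its residue class modulo n.  Let Z(S, b) be the number of
   tilings of the residual region without source < b.  Removing the source b gives
     Z(S, b) = Z(S, b + 1) + Z(S + b, b - n)      for a minimal label b,
   and Z(S, g + 1) = 0 as soon as no minimal label lies in (g, g + n], because
   following the leftmost tiles level by level one always meets a source.

   The fundamental sequences turn out to be the sets S, without 0, whose minimal
   labels 0 = m_0 < ... < m_(n-1) have all gaps < n; reading the m_i modulo n
   identifies them with the permutations of 1, ..., n - 1.  For such an S expand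
   Z(S, 0) = sum_v Z(S + v, v - n).  When removing v opens no gap, S + v is of
   the same kind, and Z(S + v, v - n) = Z(S + v, 0) - (terms u < v - n);
   when it opens one, Z(S + v, v) = 0 and only the terms u in [v - n, v) remain.
   Iterating expresses Z(S, 0) through the Z(S + T, 0), with coefficients 1, -1
   and distinct sets T of minimal labels.  Comparing cardinals, S + T determines
   T from |T| and the shifted set, so the entries are 0, 1 or -1; |T| = n only
   for the set of all minimal labels, whose removal shifts S by n. *)

Set Implicit Arguments.
Unset Strict Implicit.
Unset Printing Implicit Defensive.

Local Open Scope nat_scope.

(** * The number of free labels in a window *)

(* [lia] without the hypotheses that its preprocessing is slow on. *)
Ltac arith := repeat match goal with
  | H : is_true (in_mem _ _) |- _ => clear H
  | H : is_true (ribbon_tiling _ _) |- _ => clear H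
  | H : forall _, _ |- _ => clear H
  end; lia.

Section Width.

Variable n : nat.
Implicit Type S : pred nat.

Definition down_closed S := forall i, S (i + n) -> S i.

(** For a down-closed [S] this singles out the least free label of each residue class modulo [n]. *)
Definition minimal_free S i := ~~ S i && ((i < n) || S (i - n)).

(** A tile has one square on each of [n] consecutive levels, so the free labels in the window
    [(L - n, L]] are those of the remaining tiles that meet level [L], labels beyond the strip
    included. The guard [k <= L] keeps the subtraction from truncating. *)
Definition width S L := count (fun k => (k <= L) && ~~ S (L - k)) (iota 0 n).

Definition add_label S v : pred nat := fun i => (i == v) || S i.

Lemma width_ext S S' : S =1 S' -> width S =1 width S'.
Proof. by move=> eqS L; apply: eq_count => k; rewrite eqS. Qed.

Lemma width_le_order S L : width S L <= n.
Proof. by rewrite -[X in _ <= X](size_iota 0) count_size. Qed.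

Lemma count_iota_interval a b m :
  count (fun k => (a <= k) && (k < b)) (iota 0 m) = minn b m - a.
Proof.
elim: m => [|m IHm]; first by rewrite /=; lia.
by rewrite -[m.+1]addn1 iotaD count_cat IHm /= add0n; lia.
Qed.

Lemma width_le_level S L : width S L <= L.+1.
Proof.
have le1 : width S L <= count (fun k => (0 <= k) && (k < L.+1)) (iota 0 n).
  by apply: sub_count => k /andP[].
by apply: leq_trans le1 _; rewrite count_iota_interval; lia.
Qed.

(* Labels [>= N] are never chosen, so they fill the window from the right. *)
Lemma width_right S N L : (forall j, S j -> j < N) -> L < N + n ->
  L.+1 - N <= width S L.
Proof.
move=> ltSN ltL.
have -> : L.+1 - N = count (fun k => (0 <= k) && (k < L.+1 - N)) (iota 0 n).
  by rewrite count_iota_interval; lia.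
apply: sub_count => k /= lt_k; apply/andP; split; first lia.
by apply/negP => /ltSN; lia.
Qed.

Lemma width_gt0P S L : reflect (exists2 u, ~~ S u & u <= L < u + n) (0 < width S L).
Proof.
rewrite -has_count; apply: (iffP hasP) => [[k]|[u nSu uL]].
  by rewrite mem_iota => lek /andP[kL nS]; exists (L - k) => //; lia.
exists (L - u); first by rewrite mem_iota; lia.
by rewrite leq_subr subKn //; lia.
Qed.

Lemma minimal_free_ext S S' : S =1 S' -> minimal_free S =1 minimal_free S'.
Proof. by move=> eqS i; rewrite /minimal_free !eqS. Qed.

Hypothesis n_gt0 : 0 < n.

Lemma width0 S : width S 0 = ~~ S 0.
Proof.
rewrite /width; case: (n) n_gt0 => // m _ /=.
rewrite (eq_in_count (a2 := pred0)) ?count_pred0 ?addn0 // => k.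
by rewrite mem_iota => k_gt0; apply/negbTE; lia.
Qed.

(** Passing from [L] to [L.+1], the window gains [L.+1] and loses [L.+1 - n]. The additive form
    avoids a subtraction of widths. *)
Lemma widthS S L :
  width S L.+1 + ((n <= L.+1) && ~~ S (L.+1 - n)) = width S L + ~~ S L.+1.
Proof.
rewrite /width; case: (n) n_gt0 => // m _.
have -> : iota 0 m.+1 = iota 0 m ++ [:: m] by rewrite -addn1 iotaD.
rewrite [in RHS]count_cat.
have -> : iota 0 m ++ [:: m] = 0 :: map succn (iota 0 m).
  by rewrite -[[:: m]]/(iota (0 + m) 1) -iotaD addn1 /= (iotaDl 1 0).
rewrite /= count_map subn0 subSS ltnS addn0 [RHS]addnC addnA; congr (_ + _ + _).
Qed.

Lemma width_add S v L : ~~ S v ->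
  width (add_label S v) L + (v <= L < v + n) = width S L.
Proof.
move=> nSv; elim: L => [|L IH].
  by rewrite !width0 /add_label; have [->|] := eqVneq 0 v; rewrite ?nSv /=; lia.
have := widthS (add_label S v) L; have := widthS S L.
rewrite -{}IH /add_label.
have [eqv|neq1] /= := eqVneq L.+1 v.
  by have -> : (L.+1 - n == v) = false by [lia]; rewrite eqv nSv /=; lia.
by have [eqv|neq2] /= := eqVneq (L.+1 - n) v; first rewrite eqv nSv; lia.
Qed.

(** The strict bound comes from [width_right] applied after [i] has also been chosen, since that
    choice costs one unit of width. *)
Lemma width_right_free S N L i : (forall j, S j -> j < N) -> ~~ S i -> i < N ->
  i <= L < i + n -> L.+1 - N < width S L.
Proof.
move=> ltSN nSi lt_iN iL; rewrite -(width_add L nSi) iL addn1 ltnS.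
by apply: width_right => [j /orP[/eqP->|/ltSN]|]; rewrite //; lia.
Qed.

Lemma down_closed_add S v : down_closed S -> minimal_free S v ->
  down_closed (add_label S v).
Proof.
move=> dcS /andP[_ Mv] i /orP[/eqP eqv|/dcS Si]; apply/orP; right=> //.
by move: Mv; rewrite -eqv addnK orbC; case/orP=> //; lia.
Qed.

(** Only the residue class of [v] is affected: there [v + n] takes over as the least free label. *)
Lemma minimal_free_add S v i : down_closed S -> minimal_free S v ->
  minimal_free (add_label S v) i = (i == v + n) || (i != v) && minimal_free S i.
Proof.
move=> dcS /andP[nSv _]; rewrite /minimal_free /add_label negb_or.
have [->|neq] := eqVneq i (v + n).
  rewrite addnK eqxx orbT andbT; apply/andP; split; first lia.
  by apply: contra nSv => /dcS.
have [->|neqv] //= := eqVneq i v.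
case: (ltnP i n) => // le_ni; congr (_ && _).
by case: eqP => // eq; case/eqP: neq; rewrite -eq subnK.
Qed.

Lemma exists_minimal_free S u : ~~ S u ->
  exists2 v, minimal_free S v & v <= u.
Proof.
elim/ltn_ind: u => u IH nSu.
case Mu: (minimal_free S u); first by exists u.
move: Mu; rewrite /minimal_free nSu /= => /norP[]; rewrite -leqNgt => le_nu nS.
by have [|v Mv le_v] := IH _ _ nS; [|exists v => //]; lia.
Qed.

End Width.

(** * Ribbon tiles and residual regions *)

Section Tiles.

Variables n N : nat.
Implicit Types (s r q : square n N) (t : {set square n N}) (S : pred nat).

Lemma square_inj s s' : level s = level s' -> s.2 = s'.2 :> nat -> s = s'.
Proof.
case: s s' => [x y] [x' y']; rewrite /level /= => eqL eqy.
by congr (_, _); apply: val_inj => //=; lia.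
Qed.

Lemma exists_square L y : y <= L -> L < N + y -> y < n ->
  exists2 s : square n N, level s = L & s.2 = y :> nat.
Proof.
move=> leyL ltL ltyn; have ltx : L - y < N by lia.
by exists (Ordinal ltx, Ordinal ltyn); rewrite // /level /=; lia.
Qed.

Lemma ribbon_stepE s s' : ribbon_step s s' =
  (level s' == (level s).+1) && (s.2 <= s'.2 <= s.2.+1).
Proof.
by rewrite /ribbon_step /level; lia.
Qed.

Lemma bigmin_nat (I : eqType) (r : seq I) (F : I -> nat) m k :
  (forall i, i \in r -> k <= F i) -> k <= m -> (exists2 i, i \in r & F i = k) ->
  \big[minn/m]_(i <- r) F i = k.
Proof.
move=> lekF lekm [i0 + Fi0]; elim: r lekF => // i r IH lekF.
have lekFr : {in r, forall j, k <= F j}.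
  by move=> j rj; apply: lekF; rewrite in_cons rj orbT.
have lek_min : k <= \big[minn/m]_(j <- r) F j.
  elim: (r) lekFr => [|j r' IHr] lekFr; first by rewrite big_nil.
  rewrite big_cons leq_min lekFr ?mem_head //=.
  by apply: IHr => l rl; apply: lekFr; rewrite in_cons rl orbT.
rewrite big_cons in_cons => /orP[/eqP <-|/(IH lekFr) ->].
  by rewrite Fi0; apply/minn_idPl.
by apply/minn_idPr/lekF/mem_head.
Qed.

Lemma tile_level_eq t l : (forall s, s \in t -> l <= level s) ->
  (exists2 s, s \in t & level s = l) -> tile_level t = l.
Proof.
move=> lel [s ts eql]; rewrite /tile_level -big_filter; apply: bigmin_nat.
- by move=> r; rewrite mem_filter => /andP[/lel].
- by rewrite -eql /level; case: (s) => [x y] /=; have := ltn_ord x; have := ltn_ord y; lia.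
- by exists s; rewrite ?mem_filter ?ts ?mem_index_enum.
Qed.

(** A ribbon tile without its list of squares: the graph of a height function on the levels [i] to
    [i + n - 1], with increments 0 or 1. *)
Definition ribbon_squares t i :=
  [/\ forall s, s \in t -> i <= level s < i + n,
      forall L, i <= L < i + n -> exists2 s, s \in t & level s = L,
      {in t &, injective (@level n N)}
    & {in t &, forall s s', level s' = (level s).+1 -> s.2 <= s'.2 <= s.2.+1}].

Hypothesis n_gt0 : 0 < n.

Lemma ribbon_tileP t : ribbon_tile t -> ribbon_squares t (tile_level t).
Proof.
case/existsP => w /andP[sw /eqP tw].
have w0 : 0 < size w by rewrite size_tuple.
have [s0 s0w] : {s0 | s0 = nth (tnth w (Ordinal n_gt0)) w 0} by eexists.
have step i : i.+1 < n -> ribbon_step (nth s0 w i) (nth s0 w i.+1).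
  by move=> lti; apply: (sortedP s0) => //; rewrite size_tuple.
have lev i : i < n -> level (nth s0 w i) = level (nth s0 w 0) + i.
  elim: i => [|i IH] lti; first by rewrite addn0.
  by have := step _ lti; rewrite ribbon_stepE IH ?(ltnW lti) // => /andP[/eqP -> _]; lia.
set l := level (nth s0 w 0) in lev.
have memt s : s \in t -> exists2 i, i < n & s = nth s0 w i.
  by rewrite tw inE => /(nthP s0)[i]; rewrite size_tuple => lti <-; exists i.
have tmem i : i < n -> nth s0 w i \in t by move=> lti; rewrite tw inE mem_nth ?size_tuple.
have -> : tile_level t = l.
  apply: tile_level_eq; last by exists (nth s0 w 0); rewrite ?tmem.
  by move=> s /memt[i lti ->]; rewrite lev //; lia.
split.
- by move=> s /memt[i lti ->]; rewrite lev //; lia.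
- move=> L lL; exists (nth s0 w (L - l)); first by apply: tmem; lia.
  by rewrite lev; lia.
- move=> _ _ /memt[i lti ->] /memt[j ltj ->]; rewrite !lev // => /addnI ->; done.
- move=> _ _ /memt[i lti ->] /memt[j ltj ->]; rewrite !lev // => eqj.
  have ej : j = i.+1 by lia.
  by move: ltj; rewrite ej => /step; rewrite ribbon_stepE => /andP[].
Qed.

Lemma ribbon_squares_tile t i : ribbon_squares t i -> ribbon_tile t.
Proof.
case=> levt ext injt stept.
have [s0 ts0 _] : exists2 s, s \in t & level s = i by apply: ext; lia.
pose f k := odflt s0 [pick s in t | level s == i + k].
have fP k : k < n -> f k \in t /\ level (f k) = i + k.
  move=> ltk; rewrite /f; case: pickP => [s /andP[-> /eqP->]//|no].
  have [|s ts eqs] := ext (i + k); first lia.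
  by have := no s; rewrite ts eqs eqxx.
have sz : size (mkseq f n) == n by rewrite size_mkseq.
apply/existsP; exists (Tuple sz); apply/andP; split.
  apply/(sortedP s0) => j; rewrite size_mkseq => ltj.
  rewrite !nth_mkseq ?(ltnW ltj) //.
  have [tj levj] := fP _ (ltnW ltj); have [tj1 levj1] := fP _ ltj.
  rewrite ribbon_stepE; apply/andP; split; first by rewrite levj levj1 addnS.
  by apply: stept; rewrite // levj levj1 addnS.
apply/eqP/setP => s; rewrite inE /=; apply/idP/mapP => [ts|[k]].
  have := levt _ ts => lev; exists (level s - i); first by rewrite mem_iota; lia.
  have [|tf levf] := fP (level s - i); first lia.
  by apply: injt => //; rewrite levf; lia.
by rewrite mem_iota => /andP[_ ltk] ->; have [] := fP k ltk.
Qed.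

Lemma ribbon_squares_level t i : ribbon_squares t i -> tile_level t = i.
Proof.
case=> levt ext _ _; apply: tile_level_eq => [s /levt /andP[]//|].
by have [|s ts eqs] := ext i; [lia|exists s].
Qed.

(** Further left on a level means higher up, so the squares already covered are those at height
    [width] and above. *)
Definition region S : {set square n N} := [set s : square n N | s.2 < width n S (level s)].

(** The highest, hence leftmost, remaining square of its level. *)
Definition leading S (s : square n N) := s.2.+1 == width n S (level s).

Definition left_tile S i : {set square n N} :=
  [set s : square n N | (i <= level s < i + n) && leading S s].

Lemma leading_region S s : leading S s -> s \in region S.
Proof. by rewrite inE /leading => /eqP <-. Qed.

Lemma leading_max S s s' : leading S s -> s' \in region S -> level s' = level s ->
  s'.2 <= s.2.
Proof. by rewrite inE /leading => /eqP eqw + eqL; rewrite eqL -eqw. Qed.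

Lemma leading_inj S s s' : leading S s -> leading S s' -> level s = level s' ->
  s = s'.
Proof.
move=> /eqP ls /eqP ls' eqL; apply: square_inj => //.
by apply: succn_inj; rewrite ls ls' eqL.
Qed.

Lemma exists_leading S s : s \in region S ->
  exists2 q : square n N, leading S q & level q = level s.
Proof.
rewrite inE => lts.
have le1 := width_le_order n S (level s); have le2 := width_le_level n S (level s).
have [||| q levq eq2] := @exists_square (level s) (width n S (level s)).-1; try lia.
  by move: lts; rewrite /level; case: (s) => [x y] /=; have := ltn_ord x; lia.
by exists q; rewrite // /leading levq eq2; lia.
Qed.

Definition bounded S := forall j, S j -> j < N.

Lemma bounded_add S v : bounded S -> v < N -> bounded (add_label S v).
Proof. by move=> bS ltv j /orP[/eqP->|/bS]. Qed.

Lemma exists_leading_free S i L : bounded S -> ~~ S i -> i < N ->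
  i <= L < i + n -> exists2 q : square n N, leading S q & level q = L.
Proof.
move=> bS nSi ltiN iL; have w1 := width_right_free n_gt0 bS nSi ltiN iL.
have le1 := width_le_order n S L; have le2 := width_le_level n S L.
have [||| q levq eq2] := @exists_square L (width n S L).-1; try lia.
by exists q; rewrite // /leading levq eq2; lia.
Qed.

Lemma left_tile_squares S i : down_closed n S -> bounded S -> ~~ S i -> i < N ->
  ribbon_squares (left_tile S i) i.
Proof.
move=> dcS bS nSi ltiN; split.
- by move=> s; rewrite inE => /andP[].
- move=> L iL; have [q lq levq] := exists_leading_free bS nSi ltiN iL.
  by exists q; rewrite // inE levq iL.
- by move=> s s'; rewrite !inE => /andP[_ ls] /andP[_ ls'] /(leading_inj ls ls').
- move=> s s'; rewrite !inE => /andP[_ /eqP ls] /andP[_ /eqP ls'] eqL.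
  (* The height changes by the free label gained minus the free label lost. Down-closure excludes
     losing a free label without gaining one, so the change is 0 or 1. *)
  have := widthS n_gt0 S (level s); rewrite -eqL -ls -ls'.
  case nS: (S (level s')); case: (leqP n (level s')) => /= le; try lia.
  by rewrite (dcS (level s' - n)) ?subnK //=; lia.
Qed.

Lemma left_tile_ribbon S i : down_closed n S -> bounded S -> ~~ S i -> i < N ->
  ribbon_tile (left_tile S i).
Proof. by move=> *; apply: ribbon_squares_tile (left_tile_squares _ _ _ _). Qed.

Lemma left_tile_level S i : down_closed n S -> bounded S -> ~~ S i -> i < N ->
  tile_level (left_tile S i) = i.
Proof. by move=> *; apply: ribbon_squares_level (left_tile_squares _ _ _ _). Qed.

Lemma region_ext S S' : S =1 S' -> region S = region S'.
Proof. by move=> eqS; apply/setP => s; rewrite !inE (width_ext n eqS). Qed.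

Lemma left_tile_ext S S' i : S =1 S' -> left_tile S i = left_tile S' i.
Proof. by move=> eqS; apply/setP => s; rewrite !inE /leading (width_ext n eqS). Qed.

Lemma left_tile_sub S i : left_tile S i \subset region S.
Proof. by apply/subsetP => s; rewrite inE => /andP[_ /leading_region]. Qed.

(** The width drops by one exactly on the levels from [v] to [v + n - 1], which deletes the leading
    square there. *)
Lemma region_add S v : ~~ S v ->
  region (add_label S v) = region S :\: left_tile S v.
Proof.
move=> nSv; apply/setP => s; rewrite !inE /leading -(width_add n_gt0 (level s) nSv).
by case: (v <= _ < _) => /=; lia.
Qed.

(** Choosing [v] leaves the widths below level [v] unchanged. *)
Lemma left_tile_add S v i : ~~ S v -> i + n <= v ->
  left_tile (add_label S v) i = left_tile S i.
Proof.
move=> nSv le; apply/setP => s; rewrite !inE /leading -(width_add n_gt0 (level s) nSv).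
by case: (ltnP (level s) (i + n)) => lt; rewrite ?andbF //=; congr (_ && _); lia.
Qed.

Lemma region0 : region pred0 = [set: square n N].
Proof.
apply/setP => s; rewrite !inE /width.
rewrite (eq_count (a2 := fun k => (0 <= k) && (k < (level s).+1))); last by move=> k; rewrite andbT.
rewrite count_iota_interval /level; case: s => [x y] /=; have := ltn_ord y; lia.
Qed.

End Tiles.

(** * Each free label occurs once *)

Section Labels.

Variables n N : nat.
Implicit Types (s r q : square n N) (t R : {set square n N}) (S : pred nat).
Implicit Types P : {set {set square n N}}.

Lemma tiling_ribbon R P t : ribbon_tiling R P -> t \in P -> ribbon_tile t.
Proof. by case/andP=> _ /forall_inP; apply. Qed.

Lemma tiling_sub R P t s : ribbon_tiling R P -> t \in P -> s \in t -> s \in R.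
Proof.
by case/andP=> /and3P[/eqP <- _ _] _ tP st; apply/bigcupP; exists t.
Qed.

Lemma tiling_cover R P s : ribbon_tiling R P -> s \in R ->
  exists2 t, t \in P & s \in t.
Proof. by case/andP=> /and3P[/eqP <- _ _] _ /bigcupP. Qed.

Lemma tiling_uniq R P t t' s : ribbon_tiling R P -> t \in P -> t' \in P ->
  s \in t -> s \in t' -> t = t'.
Proof.
case/andP=> /and3P[_ tiP _] _ tP t'P st st'.
by rewrite -(def_pblock tiP tP st) (def_pblock tiP t'P st').
Qed.

Lemma tilingI R P : cover P = R -> trivIset P -> {in P, forall t, ribbon_tile t} ->
  0 < n -> ribbon_tiling R P.
Proof.
move=> cP tP rP n0; rewrite /ribbon_tiling /partition cP eqxx tP /=.
apply/andP; split; last exact/forall_inP.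
apply/negP => /rP/(ribbon_tileP n0)[_ ext _ _].
by have [|s] := ext (tile_level (set0 : {set square n N})); [lia|rewrite inE].
Qed.

Hypothesis n_gt0 : 0 < n.

(** Each square of level [L] lies in one tile, and each tile that meets level [L] does so in one
    square; [pblock] is the bijection. *)
Lemma card_tiles_at_level R P L : ribbon_tiling R P ->
  #|[set t in P | tile_level t <= L < tile_level t + n]|
  = #|[set s in R | level s == L]|.
Proof.
move=> tilP; have [/and3P[_ tiP _] _] := andP tilP.
have pb s : s \in R -> [/\ pblock P s \in P & s \in pblock P s].
  move=> sR; have [/and3P[/eqP cP _ _] _] := andP tilP.
  by split; [apply: pblock_mem|rewrite mem_pblock]; rewrite cP.
have -> : [set t in P | tile_level t <= L < tile_level t + n]
    = [set pblock P s | s in [set s in R | level s == L]].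
  apply/setP => t; rewrite inE; apply/andP/imsetP => [[tP tL]|[s]].
    have [_ ext _ _] := ribbon_tileP n_gt0 (tiling_ribbon tilP tP).
    have [s st levs] := ext _ tL; exists s; last by rewrite (def_pblock tiP tP st).
    by rewrite inE levs eqxx (tiling_sub tilP tP st).
  rewrite inE => /andP[/pb[bP sb] /eqP <-] ->; split=> //.
  by have [levt _ _ _] := ribbon_tileP n_gt0 (tiling_ribbon tilP bP); apply: levt.
apply: card_in_imset => s s'; rewrite !inE =>
  /andP[/pb[bP sb] /eqP eqs] /andP[/pb[bP' sb'] /eqP eqs'] eqb.
have [_ _ inj _] := ribbon_tileP n_gt0 (tiling_ribbon tilP bP).
by apply: inj; rewrite ?eqs ?eqs' // eqb.
Qed.

(** The right end of the strip, [x < N], cuts level [L] off below height [L.+1 - N]. *)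
Lemma card_region_level S L :
  #|[set s in region n N S | level s == L]| = width n S L - (L.+1 - N).
Proof.
have le1 := width_le_order n S L; have le2 := width_le_level n S L.
have -> : width n S L - (L.+1 - N)
    = #|[set y : 'I_n | (L.+1 - N <= y) && (y < width n S L)]|.
  rewrite cardsE cardE /enum_mem size_filter -enumT.
  rewrite -(count_map val (fun y => (L.+1 - N <= y) && (y < width n S L))).
  by rewrite val_enum_ord count_iota_interval; lia.
rewrite -(card_in_imset (f := snd)).
  apply: eq_card => y; rewrite inE; apply/imsetP/andP => [[s]|[ley lty]].
    rewrite !inE /level => /andP[lts /eqP <-] ->; split=> //.
    by case: s {lts} => [x z] /=; have := ltn_ord x; lia.
  have [||| s levs eqs] := @exists_square n N L y; try lia.
  by exists s; [rewrite !inE levs eqs lty eqxx|apply: val_inj].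
move=> s s'; rewrite !inE => /andP[_ /eqP e1] /andP[_ /eqP e2] e3.
by apply: square_inj; rewrite ?e1 ?e2 ?e3.
Qed.

(** Induction on [L]: from one level to the next, the number of tiles met rises by the tiles that
    start there and falls by those that have just ended. [widthS] gives the same balance for the
    free labels. *)
Lemma card_label S P L : bounded N S -> ribbon_tiling (region n N S) P ->
  #|[set t in P | tile_level t == L]| = ~~ S L && (L < N).
Proof.
move=> bS tilP.
have step K : #|[set t in P | tile_level t <= K.+1 < tile_level t + n]|
    + (if n <= K.+1 then #|[set t in P | tile_level t == K.+1 - n]| else 0)
    = #|[set t in P | tile_level t <= K < tile_level t + n]|
      + #|[set t in P | tile_level t == K.+1]|.
  (* The tiles that meet level [K] or [K.+1]; splitting off those that have ended, or those that
     start, gives the two sides. *)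
  pose A := [set t in P | tile_level t <= K.+1 <= tile_level t + n].
  transitivity #|A|.
    rewrite -(cardsID [set t | tile_level t + n == K.+1] A) [RHS]addnC.
    case: ifP => le; congr (_ + _); last 1 first.
    - symmetry; apply/eqP; rewrite cards_eq0; apply/eqP/setP => t; rewrite !inE.
      by apply/negbTE/negP; lia.
    - by apply: eq_card => t; rewrite !inE; case: (t \in P) => //=; lia.
    - by apply: eq_card => t; rewrite !inE; case: (t \in P) => //=; lia.
    - by apply: eq_card => t; rewrite !inE; case: (t \in P) => //=; lia.
  rewrite -(cardsID [set t | tile_level t == K.+1] A) addnC.
  by congr (_ + _); apply: eq_card => t; rewrite !inE; case: (t \in P) => //=; lia.
elim/ltn_ind: L => -[_|L IH].
  have := card_tiles_at_level 0 tilP; rewrite card_region_level width0 // => e.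
  transitivity #|[set t in P | tile_level t <= 0 < tile_level t + n]|; last by rewrite e; lia.
  by apply: eq_card => t; rewrite !inE; case: (t \in P) => //=; lia.
have := step L; rewrite !(card_tiles_at_level _ tilP) !card_region_level.
have := widthS n_gt0 S L.
have -> : (if n <= L.+1 then #|[set t in P | tile_level t == L.+1 - n]| else 0)
  = [&& n <= L.+1, ~~ S (L.+1 - n) & L.+1 - n < N].
  by case: (leqP n L.+1) => //= le; rewrite IH // ltn_subrL n_gt0.
have := @width_right n S N L bS; have := @width_right n S N L.+1 bS.
have := width_le_order n S L; have := width_le_order n S L.+1.
have : N <= L.+1 -> ~~ S L.+1 by move=> le; apply/negP => /bS; lia.
case: (S L.+1); case: (S (L.+1 - n)) => /=; lia.
Qed.

Section RegionTiling.

Variables (S : pred nat) (P : {set {set square n N}}).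
Hypotheses (bS : bounded N S) (tilP : ribbon_tiling (region n N S) P).

Lemma label_tile i : ~~ S i -> i < N -> exists2 t, t \in P & tile_level t = i.
Proof.
move=> nSi ltiN; have /eqP := card_label i bS tilP.
rewrite nSi ltiN => /cards1P[t /setP/(_ t)].
by rewrite !inE eqxx => /andP[tP /eqP]; exists t.
Qed.

Lemma label_inj t t' : t \in P -> t' \in P -> tile_level t = tile_level t' -> t = t'.
Proof.
move=> tP t'P eqt; have : #|[set t0 in P | tile_level t0 == tile_level t]| <= 1.
  by rewrite (card_label _ bS tilP) leq_b1.
by move/card_le1_eqP; apply; rewrite inE ?tP ?t'P ?eqt eqxx.
Qed.

Lemma label_free t : t \in P -> ~~ S (tile_level t) && (tile_level t < N).
Proof.
move=> tP; suff: 0 < (~~ S (tile_level t) && (tile_level t < N)) by rewrite lt0b.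
rewrite -(card_label _ bS tilP) card_gt0.
by apply/set0Pn; exists t; rewrite inE tP eqxx.
Qed.

End RegionTiling.

End Labels.

(** * Counting tilings by their sources *)

Section Sources.

Variables n N : nat.
Hypothesis n_gt0 : 0 < n.
Implicit Types (s r q : square n N) (t R : {set square n N}) (S : pred nat).
Implicit Types P Q : {set {set square n N}}.

(** Stated through leftmost tiles rather than through the orientation; [mem_sources] proves that the
    two notions agree. *)
Definition source S P i := [&& minimal_free n S i, i < N & left_tile n N S i \in P].

Lemma source_ext S S' P : S =1 S' -> source S P =1 source S' P.
Proof. by move=> eqS i; rewrite /source (minimal_free_ext n eqS) (@left_tile_ext _ _ _ _ _ eqS). Qed.

Lemma left_tile_neq S i j : down_closed n S -> bounded N S ->
  ~~ S i -> ~~ S j -> i < N -> j < N -> i != j ->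
  left_tile n N S i != left_tile n N S j.
Proof.
move=> dcS bS nSi nSj ltiN ltjN; apply: contra => /eqP eqt.
by rewrite -(left_tile_level n_gt0 dcS bS nSi ltiN) eqt left_tile_level.
Qed.

Lemma tiling_remove S P b : ~~ S b -> ribbon_tiling (region n N S) P ->
  left_tile n N S b \in P ->
  ribbon_tiling (region n N (add_label S b)) (P :\ left_tile n N S b).
Proof.
move=> nSb tilP tP; have [/and3P[/eqP cP tiP _] _] := andP tilP.
apply: tilingI => //.
- rewrite region_add //; apply/setP => s; rewrite in_setD -cP.
  apply/bigcupP/andP => [[t]|[nst /bigcupP[t tP' st]]].
    rewrite in_setD1 => /andP[net tP'] st; split; last by apply/bigcupP; exists t.
    by apply: contra net => st'; apply/eqP; exact: (tiling_uniq tilP tP' tP st st').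
  by exists t => //; rewrite in_setD1 tP' andbT; apply: contra nst => /eqP <-.
- by apply: trivIsetS tiP; apply: subsetDl.
- by move=> t; rewrite !inE => /andP[_ /(tiling_ribbon tilP)].
Qed.

Lemma left_tile_notin S Q b : ~~ S b -> down_closed n S -> bounded N S -> b < N ->
  ribbon_tiling (region n N (add_label S b)) Q -> left_tile n N S b \notin Q.
Proof.
move=> nSb dcS bS ltbN tilQ; apply/negP => tQ.
have [_ ext _ _] := left_tile_squares n_gt0 dcS bS nSb ltbN.
have [|s st _] := ext b; first lia.
by have := tiling_sub tilQ tQ st; rewrite region_add // in_setD st.
Qed.

Lemma tiling_insert S Q b : ~~ S b -> down_closed n S -> bounded N S -> b < N ->
  ribbon_tiling (region n N (add_label S b)) Q ->
  ribbon_tiling (region n N S) (left_tile n N S b |: Q).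
Proof.
move=> nSb dcS bS ltbN tilQ; have [/and3P[/eqP cQ tiQ _] _] := andP tilQ.
have sub t s : t \in Q -> s \in t -> s \notin left_tile n N S b.
  by move=> tQ st; have := tiling_sub tilQ tQ st; rewrite region_add // in_setD => /andP[].
apply: tilingI => //.
- apply/setP => s; rewrite /cover bigcup_setU big_set1 in_setU -/(cover Q) cQ region_add // in_setD.
  case st: (s \in left_tile n N S b) => //=.
  by rewrite (subsetP (left_tile_sub _ _ S b)).
- apply/trivIsetP => t t'; rewrite !in_setU1 => /orP[/eqP->|tQ] /orP[/eqP->|tQ'].
  + by rewrite eqxx.
  + by move=> _; rewrite disjoint_sym; apply/pred0P => s /=; apply/andP => -[/(sub _ _ tQ')/negP].
  + by move=> _; apply/pred0P => s /=; apply/andP => -[/(sub _ _ tQ)/negP].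
  + by move/trivIsetP: tiQ; apply.
- move=> t; rewrite in_setU1 => /orP[/eqP->|/(tiling_ribbon tilQ)//].
  exact: left_tile_ribbon.
Qed.

Section Fixed.

Variable S : pred nat.
Hypotheses (dcS : down_closed n S) (bS : bounded N S).

Lemma source_remove P b i : minimal_free n S b -> b < N -> i + n < b ->
  source (add_label S b) (P :\ left_tile n N S b) i = source S P i.
Proof.
move=> Mb ltbN lt; rewrite /source minimal_free_add //.
have -> : i == b + n = false by lia.
have -> /= : i != b by lia.
case Mi: (minimal_free n S i) => //=; case: (ltnP i N) => //= ltiN.
have [/andP[nSb _] /andP[nSi _]] := (Mb, Mi).
rewrite left_tile_add // ?(ltnW lt) // in_setD1 left_tile_neq //; lia.
Qed.

(** Two leftmost tiles that both meet level [b] share its leading square and hence coincide. The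
    case [i + n = b] is excluded because minimality of [b] would make [i] already chosen. *)
Lemma source_far P b i : ribbon_tiling (region n N S) P ->
  source S P b -> source S P i -> i < b -> i + n < b.
Proof.
move=> tilP /and3P[Mb ltbN tb] /and3P[Mi ltiN ti] ltib.
have [/andP[nSb oSb] /andP[nSi _]] := (Mb, Mi).
rewrite ltn_neqAle; apply/andP; split.
  by apply: contra nSi => /eqP eqb; move: oSb; rewrite -eqb addnK; case/orP=> //; lia.
rewrite leqNgt; apply/negP => lt.
have [q lq levq] := @exists_leading_free n N n_gt0 S b b bS nSb ltbN ltac:(lia).
suff /(congr1 (@tile_level n N)) : left_tile n N S b = left_tile n N S i.
  by rewrite !left_tile_level //; arith.
by apply: (tiling_uniq tilP tb ti (s := q)); rewrite inE levq lq andbT; arith.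
Qed.

Definition no_source b P := [forall i : 'I_N, (i < b) ==> ~~ source S P i].

Lemma no_sourceP b P : reflect (forall i, i < b -> ~~ source S P i) (no_source b P).
Proof.
apply: (iffP forallP) => [nos i ltib|nos i]; last by apply/implyP => /nos.
case: (ltnP i N) => [ltiN|leNi]; first exact: (implyP (nos (Ordinal ltiN))).
by apply/negP => /and3P[_]; lia.
Qed.

End Fixed.

(** The quantity [Z(S, b)] of the introductory comment. *)
Definition count_tilings S b :=
  #|[set P | ribbon_tiling (region n N S) P && no_source S b P]|.

Lemma count_tilings_ext S S' b : S =1 S' -> count_tilings S b = count_tilings S' b.
Proof.
move=> eqS; apply: eq_card => P; rewrite !inE (@region_ext _ _ _ _ eqS); congr (_ && _).
by apply: eq_forallb => i; rewrite (source_ext P eqS).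
Qed.

Lemma count_tilings0 S : count_tilings S 0 = #|[set P | ribbon_tiling (region n N S) P]|.
Proof.
apply: eq_card => P; rewrite !inE andbC; case: no_sourceP => // -[] //.
Qed.

(** A source [i] below [b] would satisfy [i + n < b] by [source_far], and would thus be a source of
    [Q] below [b - n]. This explains the threshold. *)
Lemma insert_source S Q b : down_closed n S -> bounded N S ->
  minimal_free n S b -> b < N -> ribbon_tiling (region n N (add_label S b)) Q ->
  no_source (add_label S b) (b - n) Q ->
  [/\ ribbon_tiling (region n N S) (left_tile n N S b |: Q),
      source S (left_tile n N S b |: Q) b
    & no_source S b (left_tile n N S b |: Q)].
Proof.
move=> dcS bS Mb ltbN tilQ /no_sourceP nosQ; have [nSb _] := andP Mb.
have tilP := tiling_insert nSb dcS bS ltbN tilQ.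
have srcb : source S (left_tile n N S b |: Q) b by rewrite /source Mb ltbN setU11.
split=> //; apply/no_sourceP => i ltib; apply/negP => srci.
have lt := source_far dcS bS tilP srcb srci ltib.
have /negP[] := nosQ i ltac:(lia); move: srci.
by rewrite -(source_remove dcS bS _ Mb ltbN lt) setU1K ?left_tile_notin.
Qed.

(** Split by whether [b] is a source; if it is, deleting its tile is a bijection. For [b < n] the
    truncated threshold [b - n] is 0 and imposes nothing, in accordance with [source_far]. *)
Lemma count_tilingsS S b : down_closed n S -> bounded N S ->
  count_tilings S b = count_tilings S b.+1
    + (if minimal_free n S b && (b < N) then count_tilings (add_label S b) (b - n) else 0).
Proof.
move=> dcS bS; set A := [set P | ribbon_tiling (region n N S) P && no_source S b P].
have -> : count_tilings S b = #|A| by [].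
rewrite -(cardsID [set P | source S P b] A) addnC; congr (_ + _).
  apply: eq_card => P; rewrite !inE andbCA; congr (_ && _).
  apply/andP/no_sourceP => [[nsb /no_sourceP nos] i|nos]; last first.
    by split; [apply: nos|apply/no_sourceP => i ltib; apply: nos; lia].
  by rewrite ltnS leq_eqVlt => /orP[/eqP->//|/nos].
case: ifP => [/andP[Mb ltbN]|nMb]; last first.
  apply/eqP; rewrite cards_eq0; apply/eqP/setP => P; rewrite !inE.
  by apply/negbTE/negP => /andP[_ /and3P[Mb ltbN _]]; rewrite Mb ltbN in nMb.
have [nSb _] := andP Mb; pose tb := left_tile n N S b.
rewrite -(card_in_imset (f := fun P => P :\ tb)); last first.
  move=> P P'; rewrite !inE => /andP[_ /and3P[_ _ tP]] /andP[_ /and3P[_ _ tP']] eqP.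
  by rewrite -(setD1K tP) eqP setD1K.
apply: eq_card => Q; rewrite inE; apply/imsetP/andP => [[P]|[tilQ nosQ]].
  rewrite !inE => /andP[/andP[tilP /no_sourceP nos] /and3P[_ _ tP]] ->.
  split; first exact: tiling_remove.
  by apply/no_sourceP => i lti; rewrite source_remove ?nos //; lia.
have [tilP srcb nosP] := insert_source dcS bS Mb ltbN tilQ nosQ.
by exists (tb |: Q); rewrite ?inE ?tilP ?nosP // setU1K // left_tile_notin.
Qed.

(* Starting from the least label, follow the leftmost tiles level by level:
   either the current tile stays leftmost up to its end, or a tile that starts
   on its left takes over, and the label of that tile is minimal as well. *)
Section LeftmostWalk.

Variables (S : pred nat) (P : {set {set square n N}}).
Hypotheses (dcS : down_closed n S) (bS : bounded N S).
Hypothesis tilP : ribbon_tiling (region n N S) P.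

(** Compare [t] with the tile [t'] of the leading square on the next level. If [t'] starts there, it
    takes over. Otherwise it already meets the level of [s], no higher than [s], and climbs too
    little to overtake, so the next square of [t] is leading. *)
Lemma leading_tile_next t s : t \in P -> s \in t -> leading S s ->
  (level s).+1 < tile_level t + n ->
  (exists s', [/\ s' \in t, leading S s' & level s' = (level s).+1]) \/
  minimal_free n S (level s).+1 /\
  exists t' s', [/\ t' \in P, tile_level t' = (level s).+1, s' \in t',
                    level s' = (level s).+1 & leading S s'].
Proof.
move=> tP st ls lt; have [levt extt injt stept] := ribbon_tileP n_gt0 (tiling_ribbon tilP tP).
have [|s' st' levs'] := extt (level s).+1; first by have := levt _ st; arith.
have [q lq levq] := exists_leading n_gt0 (tiling_sub tilP tP st').
have stp := stept _ _ st st' levs'.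
have le_s'q := leading_max lq (tiling_sub tilP tP st') (esym levq).
have [t' t'P qt'] := tiling_cover tilP (leading_region lq).
have [levt' extt' injt' stept'] := ribbon_tileP n_gt0 (tiling_ribbon tilP t'P).
have done : s' = q -> exists s', [/\ s' \in t, leading S s' & level s' = (level s).+1].
  by move=> e; exists s'; split=> //; rewrite e.
have [eqlev|nlev] := eqVneq (tile_level t') (level s).+1.
  right; split; last by exists t', q; split; rewrite ?levq ?levs'.
  have /andP[nS _] := label_free n_gt0 bS tilP t'P.
  (* Were the label [n] below also free, the width would not grow, and [t], which never descends,
     would itself contain the leading square. *)
  rewrite /minimal_free -eqlev nS /=; apply/negPn/negP => /norP[]; rewrite -leqNgt eqlev => le nS'.
  have eqw : width n S (level q) = width n S (level s).
    by rewrite eqlev in nS; have := widthS n_gt0 S (level s); rewrite levq levs' nS le nS'; arith.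
  have eqs : s' = q.
    apply: square_inj => //; move: lq ls; rewrite /leading eqw => /eqP e1 /eqP e2; arith.
  have ett : t = t' by apply: (tiling_uniq tilP tP t'P st'); rewrite eqs.
  by have := levt _ st; rewrite ett eqlev; arith.
left; apply: done; apply: square_inj => //.
have [|r rt' levr] := extt' (level s); first by have := levt' _ qt'; arith.
have stp' := stept' _ _ rt' qt' ltac:(arith).
have le_rs := leading_max ls (tiling_sub tilP t'P rt') levr.
have [e|ne] := eqVneq (r.2 : nat) s.2; last arith.
have ers : r = s by apply: square_inj.
have ett : t = t' by apply: (tiling_uniq tilP tP t'P st); rewrite -ers.
by rewrite (injt q s') // ?ett // levq.
Qed.

Definition leads i := [exists t in P, (tile_level t == i) &&
  [exists s in t, (level s == i) && leading S s]].

Lemma leads_source_or_next i : minimal_free n S i -> leads i ->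
  source S P i \/ exists j, [/\ i < j, j < i + n, minimal_free n S j & leads j].
Proof.
move=> Mi /exists_inP[t tP /andP[/eqP levi /exists_inP[s st /andP[/eqP levs ls]]]].
have [levt extt injt stept] := ribbon_tileP n_gt0 (tiling_ribbon tilP tP).
case: (boolP [exists j : 'I_(i + n), [&& i < j, minimal_free n S j & leads j]]).
  by case/existsP=> j /and3P[ltij Mj lj]; right; exists j; split.
move/existsPn => no; left.
have all k : k < n -> exists r, [/\ r \in t, leading S r & level r = i + k].
  elim: k => [|k IH] ltk; first by exists s; rewrite addn0.
  have [r [rt lr levr]] := IH (ltnW ltk).
  have [|[r' [rt' lr' levr']]|[M' [t' [s' [t'P e1 st' e2 ls']]]]] := leading_tile_next tP rt lr;
    first by rewrite levr levi; arith.
    by exists r'; split; rewrite // levr' levr addnS.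
  have ltj : (level r).+1 < i + n by rewrite levr; arith.
  have /and3P[] := no (Ordinal ltj); split=> //=; first by rewrite levr; arith.
  apply/exists_inP; exists t' => //; rewrite e1 eqxx /=.
  by apply/exists_inP; exists s' => //; rewrite e2 eqxx.
have /andP[nSi ltiN] := label_free n_gt0 bS tilP tP; rewrite levi in ltiN.
rewrite /source Mi ltiN /=; suff -> : left_tile n N S i = t by [].
apply/setP => r; rewrite inE; apply/andP/idP => [[levr lr]|rt].
  have [|r' [rt' lr' levr']] := all (level r - i); first arith.
  by rewrite (leading_inj lr lr') // levr'; arith.
have lr := levt _ rt; rewrite levi in lr; split=> //.
have [|r' [rt' lr' levr']] := all (level r - i); first arith.
by rewrite (injt r r') // levr'; arith.
Qed.

(** The walk starts at the least free label. Take the greatest leading minimal label up to [g]: a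
    successor up to [g] contradicts the choice, and one beyond [g] falls into the gap. *)
Lemma exists_source g m : minimal_free n S m -> m <= g -> m < N ->
  (forall j, g < j <= g + n -> j < N -> ~~ minimal_free n S j) ->
  exists2 i, i <= g & source S P i.
Proof.
move=> Mm lemg ltmN gap.
have [m0 M0 lem0] : exists2 m0, minimal_free n S m0 /\ m0 <= m & forall i, ~~ S i -> m0 <= i.
  have exM : exists i, minimal_free n S i by exists m.
  case: (ex_minnP exM) => m0 M0 min0; exists m0; first by split=> //; apply: min0.
  by move=> i /(exists_minimal_free n_gt0)[v Mv]; apply: leq_trans; apply: min0.
have [M0' lem0m] := M0; have [nS0 _] := andP M0'; have lt0N : m0 < N by arith.
have lead0 : leads m0.
  have [q lq levq] := @exists_leading_free n N n_gt0 S m0 m0 bS nS0 lt0N ltac:(arith).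
  have [t tP qt] := tiling_cover tilP (leading_region lq).
  have [levt _ _ _] := ribbon_tileP n_gt0 (tiling_ribbon tilP tP).
  apply/exists_inP; exists t => //; apply/andP; split.
    (* A tile that meets level [m0] has label at most [m0], and no free label is smaller. *)
    have /andP[/lem0 le1 _] := label_free n_gt0 bS tilP tP.
    by have := levt _ qt; rewrite levq eqn_leq le1 andbT => /andP[].
  by apply/exists_inP; exists q; rewrite // levq eqxx.
pose good i := [&& i <= g, minimal_free n S i & leads i].
have exg : exists i, good i by exists m0; rewrite /good M0' lead0 (leq_trans lem0m).
have [i /and3P[leig Mi leadi] maxi] := ex_maxnP exg (fun i gi => let: And3 h _ _ := and3P gi in h).
exists i => //; case: (leads_source_or_next Mi leadi) => // -[j [ltij ltj Mj leadj]].
have /exists_inP[t tP /andP[/eqP levj _]] := leadj.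
have /andP[_ ltjN] := label_free n_gt0 bS tilP tP; rewrite levj in ltjN.
case: (leqP j g) => [lejg|ltgj].
  by have := maxi j; rewrite /good lejg Mj leadj => /(_ isT); arith.
by have := gap j; rewrite Mj ltjN => /(_ ltac:(arith) isT).
Qed.

End LeftmostWalk.

Lemma count_tilings_gap S g m : down_closed n S -> bounded N S ->
  minimal_free n S m -> m <= g -> m < N ->
  (forall j, g < j <= g + n -> j < N -> ~~ minimal_free n S j) ->
  count_tilings S g.+1 = 0.
Proof.
move=> dcS bS Mm lemg ltmN gap; apply/eqP; rewrite cards_eq0; apply/eqP/setP => P.
rewrite !inE; apply/negbTE/negP => /andP[tilP /no_sourceP nos].
have [i leig srci] := exists_source bS tilP Mm lemg ltmN gap.
by have := nos i; rewrite srci => /(_ leig).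
Qed.

End Sources.

(** * Translation invariance *)

Section Shift.

Variable n : nat.
Hypothesis n_gt0 : 0 < n.
Implicit Types S : pred nat.

Lemma region_full N S : bounded N S -> (forall i, i < N -> S i) ->
  region n N S = set0.
Proof.
move=> bS full; apply/setP => s; rewrite !inE; apply/negbTE; rewrite -leqNgt.
have : width n S (level s) <= (level s).+1 - N.
  rewrite (_ : (level s).+1 - N = minn ((level s).+1 - N) n + ((level s).+1 - N - n)); last lia.
  apply: leq_trans (leq_addr _ _).
  rewrite -[minn _ _]subn0 -count_iota_interval; apply: sub_count => k /andP[lek nS] /=.
  by case: (ltnP (level s - k) N) => [/full|]; [rewrite (negbTE nS)|lia].
by rewrite /level; have := ltn_ord s.1; lia.
Qed.

Lemma tiling_set0 N P : ribbon_tiling (set0 : {set square n N}) P = (P == set0).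
Proof.
rewrite /ribbon_tiling partition_set0; have [->|] //= := eqVneq P set0.
by apply/forall_inP => t; rewrite inE.
Qed.

Lemma count_tilings_full N S b : bounded N S -> (forall i, i < N -> S i) ->
  count_tilings n N S b = 1.
Proof.
move=> bS full; rewrite -(cards1 (set0 : {set {set square n N}})).
apply: eq_card => P; rewrite !inE region_full // tiling_set0.
have [->|] //= := eqVneq P set0.
apply/(no_sourceP n_gt0) => i _; apply/negP => /and3P[/andP[nSi _] /full].
by rewrite (negbTE nSi).
Qed.

Lemma count_tilings_end N S u b : down_closed n S -> bounded N S ->
  ~~ S u -> u < N -> N <= b -> count_tilings n N S b = 0.
Proof.
move=> dcS bS nSu ltuN leNb; have [m Mm lemu] := exists_minimal_free n_gt0 nSu.
case: b leNb => [|b] leNb; first lia.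
(* The gap condition is vacuous: every label above the gap's foot is at least [N]. *)
by apply: (count_tilings_gap n_gt0 dcS bS Mm) => [||j]; lia.
Qed.

Definition shift_labels d S : pred nat := fun i => S (i + d).

Definition free_count N S := count (fun i => ~~ S i) (iota 0 N).

Lemma free_count_add N S v : ~~ S v -> v < N ->
  free_count N (add_label S v) < free_count N S.
Proof.
move=> nSv ltvN; rewrite /free_count.
have -> : iota 0 N = iota 0 v ++ v :: iota v.+1 (N - v.+1).
  by rewrite -[v :: _]/(iota v (N - v.+1).+1) -iotaD; congr iota; lia.
rewrite !count_cat /= nSv {2}/add_label eqxx /= add0n add1n addnS ltnS leq_add //.
  by apply: sub_count => i /=; rewrite negb_or => /andP[].
by apply: sub_count => i /=; rewrite negb_or => /andP[].
Qed.

(** Both sides obey the recursion [count_tilingsS]; the induction is on the number of free labels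
    and, inside it, on [N - b]. *)
Lemma count_tilings_shift1 N S b : down_closed n S -> bounded N.+1 S -> S 0 ->
  count_tilings n N.+1 S b.+1 = count_tilings n N (shift_labels 1 S) b.
Proof.
have [k] := ubnP (free_count N.+1 S); elim: k S b => // k IH S b lek dcS bS S0.
have [full|] := boolP (all S (iota 0 N.+1)).
  have full' i : i < N.+1 -> S i by move=> lt; apply: (allP full); rewrite mem_iota.
  rewrite !count_tilings_full // => [i|i lt]; first by move/bS; rewrite addn1.
  by apply: full'; rewrite addn1.
move/allPn => [[|u]]; first by rewrite S0.
rewrite mem_iota /= add0n ltnS => ltuN nSu.
have dcS' : down_closed n (shift_labels 1 S).
  by move=> i; rewrite /shift_labels addnAC => /dcS.
have bS' : bounded N (shift_labels 1 S) by move=> i /bS; rewrite addn1.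
have [m] := ubnP (N - b); elim: m b => // m IHm b lem.
have [leNb|ltbN] := leqP N b.
  rewrite (@count_tilings_end N.+1 S u.+1) // (@count_tilings_end N _ u) //.
  by rewrite /shift_labels addn1.
rewrite count_tilingsS // [RHS]count_tilingsS // IHm; last lia.
congr (_ + _); rewrite ltnS.
have -> : minimal_free n (shift_labels 1 S) b = minimal_free n S b.+1.
  rewrite /minimal_free /shift_labels !addn1; case: (ltngtP b.+1 n) => lt.
  - by [].
  - by rewrite subSn.
  - by rewrite lt subnn S0.
case: ifP => // /andP[Mb _]; have [nSb _] := andP Mb.
have lt1 : free_count N.+1 (add_label S b.+1) < k.
  by rewrite -ltnS; apply: leq_trans lek; rewrite ltnS free_count_add.
have dcS1 := down_closed_add n_gt0 dcS Mb.
have bS1 : bounded N.+1 (add_label S b.+1) by apply: bounded_add.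
have S10 : add_label S b.+1 0 by rewrite /add_label S0 orbT.
(* For [b < n] both truncated thresholds vanish; 0 may be replaced by 1 because the chosen label 0
   is no source. *)
transitivity (count_tilings n N.+1 (add_label S b.+1) (b - n).+1).
  have [leb|ltb] := leqP n b; first by rewrite subSn.
  have -> : b - n = 0 by lia.
  have -> : b.+1 - n = 0 by lia.
  by rewrite count_tilingsS // /minimal_free S10 addn0.
rewrite IH //; apply: count_tilings_ext => i.
by rewrite /shift_labels /add_label addn1 eqSS.
Qed.

Lemma count_tilings_shift d N S : down_closed n S -> bounded (N + d) S ->
  (forall i, i < d -> S i) ->
  count_tilings n (N + d) S 0 = count_tilings n N (shift_labels d S) 0.
Proof.
elim: d S => [|d IH] S dcS bS Sd.
  by rewrite addn0; apply: count_tilings_ext => i; rewrite /shift_labels addn0.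
rewrite addnS count_tilingsS -?addnS // {1}/minimal_free Sd // addn0 addnS.
rewrite count_tilings_shift1 ?IH ?Sd -?addnS //.
- by apply: count_tilings_ext => i; rewrite /shift_labels -addnA addn1.
- by move=> i; rewrite /shift_labels addnAC => /dcS.
- by move=> i /bS; rewrite addn1 addnS.
- by move=> i lti; rewrite /shift_labels addn1 Sd.
Qed.

End Shift.

(** * Expansion over sets of minimal labels *)

Section Connected.

Variable n : nat.
Hypothesis n_gt0 : 0 < n.
Implicit Types (S : pred nat) (l : seq nat).

Local Notation M := (minimal_free n).

Definition not_last S x := exists2 y, M S y & x < y.
Definition close_next S x := exists2 y, M S y & x < y < x + n.
(** Says that consecutive minimal labels differ by less than [n], without listing them in order. *)
Definition connected S := forall x, M S x -> not_last S x -> close_next S x.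

Lemma minimal_free_next S x : M S x -> ~~ M S (x + n).
Proof.
move=> /andP[nSx _]; rewrite /minimal_free addnK (negbTE nSx) orbF.
by apply/negP => /andP[_]; lia.
Qed.

(** Choosing [u] creates the label [u + n], a close successor for the labels [x > u] with
    [x + n < w]. Its own close successor is [w] if that is larger, and otherwise the successor of
    the greatest minimal label below [u + n]. *)
Lemma close_next_add S u w : down_closed n S -> M S u -> M S w -> w < u + n + n ->
  (forall x, M S x -> w <= x + n -> not_last S x -> close_next S x) ->
  forall x, M (add_label S u) x -> u <= x ->
    not_last (add_label S u) x -> close_next (add_label S u) x.
Proof.
move=> dcS Mu Mw ltw cl x; have M' := minimal_free_add n_gt0 _ dcS Mu.
have nMun := minimal_free_next Mu.
have lift y : M S y -> y != u -> M (add_label S u) y by move=> My ne; rewrite M' ne My orbT.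
rewrite M' => /orP[/eqP ->|/andP[nexu Mx]] leux [y].
  rewrite M' => /orP[/eqP ->|/andP[neyu My]] lty; first lia.
  have [lewu|ltuw] := leqP w (u + n); last first.
    by exists w; [apply: lift => //; lia|lia].
  have exy : exists y0, M S y0 && (y0 < u + n) by exists u; rewrite Mu; lia.
  have [y0 /andP[My0 lt0] max0] := ex_maxnP exy (fun i h => ltnW (proj2 (andP h))).
  have leu0 : u <= y0 by apply: max0; rewrite Mu; lia.
  have [||y1 My1 /andP[lt1 lt2]] := cl _ My0; [lia|by exists y => //; lia|].
  exists y1; first by apply: lift => //; lia.
  have : y1 != u + n by apply: contra nMun => /eqP <-.
  have : ~~ (y1 < u + n) by apply/negP => lt; have := max0 y1; rewrite My1 lt => /(_ isT); lia.
  lia.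
have [lewx|ltxw] := leqP w (x + n); last first.
  by exists (u + n); [rewrite M' eqxx|lia].
rewrite M' => /orP[/eqP -> lty|/andP[neyu My] lty].
  by exists (u + n); [rewrite M' eqxx|lia].
have [|y1 My1 lt1] := cl _ Mx lewx; first by exists y.
by exists y1 => //; apply: lift => //; lia.
Qed.

(* After [v] has been chosen, the only place where two consecutive minimal
   labels can be further than [n] apart is around [v]. *)
Definition frontier_after S v :=
  [/\ down_closed n S, M S (v + n),
      forall x, M S x -> v <= x -> not_last S x -> close_next S x
    & forall x, M S x -> x < v -> exists2 y, M S y || (y == v) & (x < y < x + n) && (y <= v)].

Lemma frontier_add S u w v : down_closed n S -> M S u -> M S w -> w < u + n + n ->
  (forall x, M S x -> w <= x + n -> not_last S x -> close_next S x) ->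
  (forall x, M S x -> x < u -> exists2 y, M S y || (y == v) & (x < y < x + n) && (y <= v)) ->
  u < v -> frontier_after (add_label S u) u.
Proof.
move=> dcS Mu Mw ltw cl clv ltuv; have M' := minimal_free_add n_gt0 _ dcS Mu.
split.
- exact: down_closed_add.
- by rewrite M' eqxx.
- exact: close_next_add ltw cl.
- move=> x; rewrite M' => /orP[/eqP ->|/andP[nexu Mx]] ltxu; first lia.
  have [y /orP My lty] := clv _ Mx ltxu.
  have [leyu|ltuy] := leqP y u; last by exists u; [rewrite eqxx orbT|lia].
  exists y; last lia.
  have [->|ne] := eqVneq y u; first by rewrite orbT.
  by case: My => [My|/eqP]; [rewrite M' ne My orbT|lia].
Qed.

Definition has_gap S v :=
  has (fun p => M S p && ~~ has (M S) (iota p.+1 n.-1)) (iota 0 v).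

(** The test inspects [n - 1] labels only, as [p + n] is never minimal together with [p]; the whole
    window [(p, p + n]] is what [count_tilings_gap] asks for. *)
Lemma has_gapP S v : reflect (exists p, [/\ p < v, M S p &
   forall y, p < y <= p + n -> ~~ M S y]) (has_gap S v).
Proof.
apply: (iffP hasP) => [[p]|[p [ltpv Mp gap]]].
  rewrite mem_iota => /= ltpv /andP[Mp /hasPn gap]; exists p; split=> // y lty.
  have [->|ne] := eqVneq y (p + n); first exact: minimal_free_next.
  by apply: gap; rewrite mem_iota; lia.
exists p; rewrite ?mem_iota ?Mp //=; apply/hasPn => y; rewrite mem_iota => lty.
by apply: gap; lia.
Qed.

Lemma frontier_connected S v : frontier_after S v -> ~~ has_gap S v -> connected S.
Proof.
move=> [_ _ cl _] /has_gapP ng x Mx nlx.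
have [levx|ltxv] := leqP v x; first exact: cl.
case: (boolP (has (M S) (iota x.+1 n.-1))) => [/hasP[y]|/hasPn no].
  by rewrite mem_iota => lty My; exists y => //; lia.
case: ng; exists x; split=> // y lty.
have [->|ne] := eqVneq y (x + n); first exact: minimal_free_next.
by apply: no; rewrite mem_iota; lia.
Qed.

(** The window [[v - n, v)] has length [v - (v - n)], which is less than [n] for small [v]. *)
Definition next_picks S v (gap : bool) :=
  [seq u <- if gap then iota (v - n) (v - (v - n)) else iota 0 (v - n) | M S u].

Lemma frontier_pick S v u : frontier_after S v -> u \in next_picks S v (has_gap S v) ->
  [/\ M S u, u < v & frontier_after (add_label S u) u].
Proof.
move=> fr; rewrite mem_filter => /andP[Mu]; have [dcS Mv cl clv] := fr.
case: ifP => [_|/negbT ng]; rewrite mem_iota => inu.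
  (* Minimality of [v + n] means that [v] is chosen, so [u + n = v] would make [u] chosen too. *)
  have neu : u + n != v.
    have /andP[_] := Mv; rewrite addnK; apply: contraTneq => /= e.
    rewrite negb_or -e; apply/andP; split; first lia.
    by have /andP[+ _] := Mu; apply: contra => /dcS.
  have ltuv : u < v by lia.
  split=> //; apply: (frontier_add dcS Mu Mv _ _ _ ltuv); first lia.
    by move=> x Mx; rewrite leq_add2r; apply: cl.
  by move=> x Mx ltxu; apply: clv => //; lia.
have ltuv : u < v by lia.
have con := frontier_connected fr ng.
split=> //; apply: (frontier_add dcS Mu Mu _ _ _ ltuv); first lia.
  by move=> x Mx _; apply: con.
by move=> x Mx ltxu; apply: clv => //; lia.
Qed.

Definition add_labels S l := foldl add_label S l.

Lemma add_labelsE S l : add_labels S l =1 (fun i => (i \in l) || S i).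
Proof.
elim: l S => [|v l IH] S i //=.
by rewrite IH /add_label in_cons orbCA orbA.
Qed.

(* Signed list of the sets of minimal labels whose removal yields the number of
   tilings in which [v] was the last label removed: without a gap one may stop,
   or else subtract the tilings with a source that should have come earlier;
   with a gap some label in the window of [v] has to be removed next. *)
Fixpoint expansion k S v : seq (bool * seq nat) :=
  if k is k'.+1 then
    let gap := has_gap S v in
    (if gap then [::] else [:: (false, [::])]) ++
    [seq (~~ gap (+) p.1, u :: p.2)
       | u <- next_picks S v gap, p <- expansion k' (add_label S u) u]
  else [::].

Lemma expansion_uniq k S v : uniq (map snd (expansion k S v)).
Proof.
elim: k S v => //= k IH S v; set gap := has_gap S v.
rewrite map_cat map_allpairs /=.
rewrite -(allpairs_mapr (fun u l => u :: l) (fun u p => p.2) _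
  (fun u => expansion k (add_label S u) u)).
have U : uniq [seq u :: l | u <- next_picks S v gap, l <- map snd (expansion k (add_label S u) u)].
  apply: allpairs_uniq_dep; first by rewrite filter_uniq //; case: ifP; rewrite iota_uniq.
    by move=> u _; apply: IH.
  by move=> [u l] [u' l'] _ _ /= [-> ->].
by rewrite cat_uniq U andbT; case: (gap) => /=; apply/hasPn => // _ /allpairsPdep[? [? [_ _ ->]]].
Qed.

(** Picks descend, and choosing [u] only creates [u + n], above all later picks, so each pick is
    minimal in [S] from the outset. A list stops only where no gap is left, hence the
    connectedness. *)
Lemma expansion_mem k S v e l : frontier_after S v -> (e, l) \in expansion k S v ->
  [/\ path gtn v l, all (M S) l & connected (add_labels S l)].
Proof.
elim: k S v e l => //= k IH S v e l fr.
rewrite mem_cat => /orP[|/allpairsPdep[u [[e' l'] [/(frontier_pick fr)[Mu ltuv fru] /(IH _ _ _ _ fru)[pth al con] [_ ->]]]]].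
  case: ifP => // /negbT/(frontier_connected fr) con; rewrite inE => /eqP[_ ->].
  by split.
split=> //=; first by rewrite ltuv pth.
rewrite Mu /=; have [dcS _ _ _] := fr.
have gtu : {in l', forall x, x < u}.
  by apply/allP/(order_path_min _ pth) => x y z /= lt1 lt2; apply: ltn_trans lt2 lt1.
apply/allP => x xl; have := allP al x xl; have := gtu _ xl.
by rewrite minimal_free_add // => ltx; case: eqP => [|_ /andP[]//]; lia.
Qed.

(** With no minimal label in [[v, v + n)], the greatest one below [v] is the foot of a gap. It may
    therefore be picked without a change of sign, and the same situation recurs below it. *)
Lemma expansion_all k S v : v < k -> frontier_after S v ->
  (forall x, M S x -> (x < v) || (v + n <= x)) ->
  (false, rev [seq x <- iota 0 v | M S x]) \in expansion k S v.
Proof.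
elim: k S v => // k IH S v ltvk fr far; rewrite /= mem_cat.
have [dcS Mv cl clv] := fr.
case: (boolP (has (M S) (iota 0 v))) => [/hasP[x0]|no]; last first.
  apply/orP; left; have -> : [seq x <- iota 0 v | M S x] = [::].
    by apply/eqP; rewrite -[_ == _]negbK -has_filter.
  case: has_gapP => [[p [ltpv Mp _]]|]; last by rewrite inE.
  by move/hasPn: no => /(_ p); rewrite mem_iota Mp => /(_ ltpv).
rewrite mem_iota => /= lt0 M0; apply/orP; right.
have exu : exists u, (u < v) && M S u by exists x0; rewrite lt0.
have [u /andP[ltuv Mu] maxu] := ex_maxnP exu (fun i h => ltnW (proj1 (andP h))).
have neu x : M S x -> x < v -> x <= u by move=> Mx lt; apply: maxu; rewrite lt.
have [y /orP My /andP[/andP[lt1 lt2] lt3]] := clv _ Mu ltuv.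
have eyv : y = v.
  by case: My => [My|/eqP//]; have := neu _ My; have := far _ My; lia.
have gap : has_gap S v.
  apply/has_gapP; exists u; split=> // z ltz; apply/negP => Mz.
  have := far _ Mz; have := neu _ Mz.
  have : z != u + n by apply: contraTneq Mz => ->; apply: minimal_free_next.
  lia.
have pick : u \in next_picks S v (has_gap S v).
  by rewrite gap mem_filter Mu mem_iota; lia.
have [_ _ fru] := frontier_pick fr pick.
apply/allpairsPdep; exists u, (false, rev [seq x <- iota 0 u | M (add_label S u) x]).
split=> //; rewrite ?gap //=.
  apply: IH => //; first lia.
  move=> x; rewrite minimal_free_add // => /orP[/eqP->|/andP[nex Mx]]; first lia.
  by have := neu _ Mx; have := far _ Mx; lia.
congr (_, _).
have -> : iota 0 v = iota 0 u ++ u :: iota u.+1 (v - u.+1).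
  by rewrite -[u :: _]/(iota u (v - u.+1).+1) -iotaD; congr iota; lia.
rewrite filter_cat /= Mu.
have -> : [seq x <- iota u.+1 (v - u.+1) | M S x] = [::].
  apply/eqP; rewrite -[_ == _]negbK -has_filter; apply/hasPn => x.
  by rewrite mem_iota => inx; apply/negP => Mx; have := neu _ Mx; lia.
rewrite cats1 rev_rcons; congr (_ :: rev _); apply: eq_in_filter => x.
rewrite mem_iota minimal_free_add // => inx.
by have [-> ->] : (x == u + n = false) /\ x != u by lia.
Qed.

Import GRing.Theory.
Local Open Scope ring_scope.

Lemma count_tilings_telescope N S a m : down_closed n S -> bounded N S -> (a + m <= N)%N ->
  count_tilings n N S a = (count_tilings n N S (a + m)
   + \sum_(u <- [seq u <- iota a m | M S u]) count_tilings n N (add_label S u) (u - n))%N.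
Proof.
move=> dcS bS; elim: m a => [|m IH] a lea; first by rewrite big_nil !addn0.
rewrite count_tilingsS // IH; last lia.
rewrite addSnnS /= (_ : (a < N)%N); last lia.
case: (M S a) => /=; last by rewrite addn0.
by rewrite big_cons -addnA; congr (_ + _)%N; rewrite addnC.
Qed.

(** Telescoping over [[v - n, v)] if there is a gap, over [[0, v - n)] otherwise, and then induction
    for each pick. As picks descend, [v < k] is enough fuel. *)
Lemma count_tilings_expansion N k S v : (v < k)%N -> (v < N)%N -> bounded N S ->
  frontier_after S v ->
  (count_tilings n N S (v - n))%:Z =
  \sum_(p <- expansion k S v) (-1) ^+ p.1 * (count_tilings n N (add_labels S p.2) 0)%:Z.
Proof.
elim: k S v => // k IH S v ltvk ltvN bS fr; have [dcS Mv cl clv] := fr.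
rewrite /= big_cat big_allpairs_dep /=.
have picks : \sum_(u <- next_picks S v (has_gap S v))
    \sum_(p <- expansion k (add_label S u) u) (-1) ^+ (~~ has_gap S v (+) p.1)%N *
      (count_tilings n N (add_labels (add_label S u) p.2) 0)%:Z
  = (-1) ^+ (~~ has_gap S v) *
    ((\sum_(u <- next_picks S v (has_gap S v)) count_tilings n N (add_label S u) (u - n))%N%:Z).
  rewrite raddf_sum /= mulr_sumr; apply: eq_big_seq => u pu.
  have [Mu ltuv fru] := frontier_pick fr pu.
  rewrite IH //; [|lia|lia|by apply: bounded_add => //; lia].
  rewrite mulr_sumr; apply: eq_bigr => p _.
  by rewrite signr_addb mulrA.
rewrite picks /next_picks; case: has_gapP => [[p [ltpv Mp gap]]|_].
  rewrite big_nil add0r expr0 mul1r (@count_tilings_telescope N S (v - n) (v - (v - n))) //;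
    last lia.
  rewrite subnKC ?leq_subr //; suff -> : count_tilings n N S v = 0%N by [].
  have zp : count_tilings n N S p.+1 = 0%N.
    apply: (count_tilings_gap n_gt0 dcS bS Mp); [by []|lia|].
    by move=> j inj _; apply: gap.
  (* A count that is zero at threshold [p.+1] stays zero at [v], since a larger threshold only
     discards tilings. *)
  move: zp; rewrite (@count_tilings_telescope N S p.+1 (v - p.+1)) //; last lia.
  by rewrite subnKC // => /eqP; rewrite addn_eq0 => /andP[/eqP].
rewrite big_seq1 expr0 mul1r expr1 mulN1r.
rewrite [in X in X - _](@count_tilings_telescope N S 0 (v - n)) //; last lia.
by rewrite add0n PoszD addrK.
Qed.

Definition recurrence_terms F B : seq (bool * seq nat) :=
  [seq (p.1, u :: p.2) | u <- [seq u <- iota 0 B | M F u], p <- expansion B (add_label F u) u].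

Lemma connected_pick S u : down_closed n S -> connected S -> M S u ->
  frontier_after (add_label S u) u.
Proof.
(* Here [u + n] is merely an upper bound for the successors of labels below [u]. *)
move=> dcS con Mu; apply: (frontier_add (v := u + n) dcS Mu Mu); try lia.
  by move=> x Mx _; apply: con.
move=> x Mx ltxu; have [|y My lty] := con _ Mx; first by exists u.
by exists y; [rewrite My|lia].
Qed.

End Connected.

(** * Sources of the orientation of a tiling *)

Section TilingSequences.

Variables n N : nat.
Hypothesis n_gt0 : 0 < n.
Implicit Types (s r q : square n N) (t R : {set square n N}) (S : pred nat).
Implicit Types (P Q : {set {set square n N}}) (c w J : seq nat).

Lemma leading_tileE S t : ribbon_tile t -> (forall s, s \in t -> leading S s) ->
  t = left_tile n N S (tile_level t).
Proof.
move=> /(ribbon_tileP n_gt0)[levt extt injt _] lt.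
apply/setP => s; rewrite inE; apply/idP/andP => [st|[levs ls]].
  by rewrite levt ?lt.
have [r rt levr] := extt _ levs.
by rewrite (leading_inj ls (lt _ rt)).
Qed.

Section Arrows.

Variables (S : pred nat) (Q : {set {set square n N}}).
Hypotheses (dcS : down_closed n S) (bS : bounded N S).
Hypothesis tilQ : ribbon_tiling (region n N S) Q.

Let rib t (tQ : t \in Q) := ribbon_tileP n_gt0 (tiling_ribbon tilQ tQ).

(* Otherwise the tiles to the left of [t'] at level [i] would all have to shift
   one square further, and there is no room for the leftmost one. *)
Lemma forced_left t t' s s' i : t \in Q -> t' \in Q -> n <= i ->
  tile_level t = i - n -> tile_level t' = i -> s \in t -> s' \in t' ->
  level s = i.-1 -> level s' = i -> s'.2 <= s.2.
Proof.
move=> tQ t'Q leni levt levt' st st' levs levs'.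
have /andP[nSi ltiN] := label_free n_gt0 bS tilQ t'Q.
have /andP[nSin _] := label_free n_gt0 bS tilQ tQ.
rewrite levt' in nSi ltiN; rewrite levt in nSin.
(* Both [i - n] and [i] are free, so the window gains one free label and loses one. *)
have eqw : width n S i = width n S i.-1.
  have := widthS n_gt0 S i.-1; rewrite prednK ?leni ?nSi ?nSin /=; arith.
have [rt1 rt2 rt3 rt4] := rib tQ; have [rt'1 rt'2 rt'3 rt'4] := rib t'Q.
rewrite leqNgt; apply/negP => lts.
have ltw : s'.2 < width n S i by have := tiling_sub tilQ t'Q st'; rewrite inE levs'.
have lewi := width_le_level n S i.-1; have lewn := width_le_order n S i.
have shift y : s'.2 <= y < width n S i -> exists t1 r r', [/\ t1 \in Q, r \in t1 /\ r' \in t1,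
    level r = i.-1 /\ level r' = i, r.2 = y :> nat & y <= r'.2 <= y.+1].
  move=> lty; have [r levr er] : exists2 r : square n N, level r = i.-1 & r.2 = y :> nat.
    by apply: exists_square; arith.
  have [t1 t1Q rt] : exists2 t1, t1 \in Q & r \in t1.
    by apply: (tiling_cover tilQ); rewrite inE levr er -eqw; arith.
  have [q1 q2 q3 q4] := rib t1Q.
  have lev1 : tile_level t1 != i - n.
    apply/eqP => e; have e' : t1 = t by apply: (label_inj n_gt0 bS tilQ) => //; rewrite e levt.
    by rewrite e' in rt; have ers := rt3 _ _ rt st; rewrite ers ?levr // in er; arith.
  have [|r' r't1 levr'] := q2 i; first by have := q1 _ rt; rewrite levr; arith.
  exists t1, r, r'; split=> //; rewrite -er; apply: q4 => //; rewrite levr levr'; arith.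
(* For the greatest [d] the last square would have height [width n S i], outside the region. *)
suff chain d : s'.2 + d < width n S i -> exists t1 r r', [/\ t1 \in Q, r \in t1 /\ r' \in t1,
    level r = i.-1 /\ level r' = i, r.2 = s'.2 + d :> nat & r'.2 = s'.2 + d.+1 :> nat].
  have [|t1 [r [r' [t1Q [_ r't1] [_ levr'] _ er']]]] := chain (width n S i - s'.2.+1); first arith.
  by have := tiling_sub tilQ t1Q r't1; rewrite inE levr'; arith.
elim: d => [|d IH] ltd.
  have [|t1 [r [r' [t1Q [rt r't] [levr levr'] er er']]]] := shift s'.2; first arith.
  exists t1, r, r'; split=> //; rewrite ?addn0 ?addn1 //.
  have [e|ne] := eqVneq (r'.2 : nat) s'.2; last arith.
  have ers : r' = s' by apply: square_inj; rewrite ?levr' ?levs'.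
  have ett : t1 = t' by apply: (tiling_uniq tilQ t1Q t'Q r't); rewrite ers.
  by rewrite ett in rt; have := rt'1 _ rt; rewrite levt' levr; arith.
have [|t1 [r [r' [t1Q [rt r't] [levr levr'] er er']]]] := shift (s'.2 + d.+1); first arith.
exists t1, r, r'; split=> //.
have [e|ne] := eqVneq (r'.2 : nat) (s'.2 + d.+1); last arith.
have [|t0 [r0 [r0' [t0Q [r0t r0't] [levr0 levr0'] er0 er0']]]] := IH; first arith.
have ers : r' = r0' by apply: square_inj; rewrite ?levr' ?levr0' // e er0'.
have ett : t1 = t0 by apply: (tiling_uniq tilQ t1Q t0Q r't); rewrite ers.
rewrite -ett in r0t; have [_ _ q3 _] := rib t1Q.
by have err := q3 _ _ rt r0t; rewrite err ?levr // in er; arith.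
Qed.

(** On the levels of the leftmost tile every other square of the region is lower, hence further
    right. The adjacent levels at both ends are settled by [widthS]. *)
Lemma left_tile_not_right i t s s' : minimal_free n S i -> i < N ->
  left_tile n N S i \in Q -> t \in Q -> t != left_tile n N S i ->
  s \in t -> s' \in left_tile n N S i -> ~~ square_left s s'.
Proof.
move=> Mi ltiN tiQ tQ net st st'; have [nSi oSi] := andP Mi.
have neq q : q \in left_tile n N S i -> s <> q.
  by move=> qt e; case/eqP: net; apply: (tiling_uniq tilQ tQ tiQ st); rewrite e.
have [q1 q2 q3 q4] := left_tile_squares n_gt0 dcS bS nSi ltiN.
have sR := tiling_sub tilQ tQ st.
have lead q : q \in left_tile n N S i -> q.2.+1 = width n S (level q) :> nat.
  by rewrite inE => /andP[_ /eqP].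
have ltw : s.2 < width n S (level s) by rewrite inE in sR.
have gtlead q : q \in left_tile n N S i -> level q = level s -> s.2 < q.2.
  move=> qt eql; have := lead _ qt; rewrite eql => e.
  rewrite ltn_neqAle; apply/andP; split; last arith.
  by apply/eqP => e2; apply: (neq _ qt); apply: square_inj.
have levs' := q1 _ st'; have leads' := lead _ st'.
apply/negP; rewrite /square_left => /orP[/andP[/eqP eql ltx]|/andP[/andP[/orP[]/eqP eql lex] ley]].
- by have := gtlead _ st' (esym eql); move: eql ltx; rewrite /level; arith.
- have lt2 : s'.2 < s.2 by move: eql lex; rewrite /level; arith.
  have := widthS n_gt0 S (level s'); rewrite -eql.
  have [ltl|gel] := ltnP (level s) (i + n).
    have [|q qt levq] := q2 (level s); first arith.
    by have := gtlead _ qt levq; have := q4 _ _ st' qt; rewrite levq eql => /(_ erefl); arith.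
  (* One level past the tile the window has lost the free label [i], so the width has not grown. *)
  have -> : level s = i + n by arith.
  rewrite addnK nSi leq_addl /=; have := lead _ st'; have -> : i + n = level s by arith.
  arith.
have := widthS n_gt0 S (level s); rewrite -eql.
have [lel|gtl] := leqP i (level s).
  have [|q qt levq] := q2 (level s); first arith.
  by have := gtlead _ qt levq; have := q4 _ _ qt st'; rewrite levq eql => /(_ erefl); arith.
(* At the first level of the tile the window gains [i] and, by minimality, loses no free label, so
   the width exceeds that of the level before by one. *)
have -> : level s' = i by arith.
rewrite nSi; have := lead _ st'; have -> : level s' = i by arith.
have nl : (n <= i) && ~~ S (i - n) = false.
  by case/orP: oSi => [lt|->]; [rewrite leqNgt lt|rewrite andbF].
rewrite nl addn0; move: ltw ley => {lead gtlead q1 q2 q3 q4}; move: (width _ _ _) => w1.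
by move: (width _ _ _) => w2; arith.
Qed.

End Arrows.

Definition rest P c : {set {set square n N}} := [set t in P | tile_level t \notin c].

Lemma head_sortedP (r : seq nat) v : sorted ltn r ->
  (take 1 r == [:: v]) = (v \in r) && all (leq v) r.
Proof.
case: r => //= u r pr; rewrite take0 in_cons.
have lt_u : all (ltn u) r by apply: order_path_min pr; apply: ltn_trans.
apply/eqP/andP => [[<-]|[/orP[/eqP->//|vr] /andP[le_vu _]]].
  by rewrite eqxx leqnn /=; split=> //; apply: sub_all lt_u => x /ltnW.
by have := allP lt_u v vr; rewrite /= ltnNge le_vu.
Qed.

Section FullTiling.

Variable P : {set {set square n N}}.
Hypothesis tilP : ribbon_tiling [set: square n N] P.

Let bpred0 : bounded N pred0. Proof. by []. Qed.
Let tilP0 : ribbon_tiling (region n N pred0) P. Proof. by rewrite region0. Qed.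

Lemma rest_nil : rest P [::] = P.
Proof. by apply/setP => t; rewrite !inE andbT. Qed.

Lemma mem_rcons_label c v : mem (rcons c v) =1 add_label (mem c) v.
Proof. by move=> i; rewrite /= mem_rcons in_cons. Qed.

Section Prefix.

Variable c : seq nat.
Hypotheses (dc : down_closed n (mem c)) (bc : bounded N (mem c)).
Hypothesis tilr : ribbon_tiling (region n N (mem c)) (rest P c).

(** A source must be minimal, as otherwise [forced_left] gives an arrow from label [i - n]; and its
    squares must be leading, as otherwise the tile of the leading square has an arrow to it.
    Conversely, [left_tile_not_right] forbids arrows into a leftmost tile. *)
Lemma mem_sources i : (i \in sources P c) = source (mem c) (rest P c) i.
Proof.
rewrite mem_filter mem_iota add0n /=; apply/andP/and3P => [[/andP[nci nar] ltiN]|[Mi ltiN tiQ]].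
  have [t tQ levt] := label_tile n_gt0 bc tilr nci ltiN.
  have tP : t \in P by move: tQ; rewrite inE => /andP[].
  have noar t' : t' \in rest P c -> label_edge n (tile_level t') i -> ~~ tile_left t' t.
    move=> t'Q edge; apply: contra nar => left; have t'P := t'Q; rewrite inE in t'P.
    have /andP[_ ltN] := label_free n_gt0 bc tilr t'Q; have [t'P' nc] := andP t'P.
    apply/hasP; exists (tile_level t'); first by rewrite mem_iota.
    rewrite nc /label_arrow edge /=; apply/exists_inP; exists t' => //.
    by apply/exists_inP; exists t; rewrite // levt !eqxx.
  have [levt1 extt _ _] := ribbon_tileP n_gt0 (tiling_ribbon tilr tQ).
  have Mi : minimal_free n (mem c) i.
    rewrite /minimal_free nci /=; apply/negPn/negP => /norP[]; rewrite -leqNgt => leni nS.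
    have [|t' t'Q levt'] := label_tile n_gt0 bc tilr nS; first arith.
    have [levt'1 extt' _ _] := ribbon_tileP n_gt0 (tiling_ribbon tilr t'Q).
    have [|s st levs] := extt i; first arith.
    have [|s' st' levs'] := extt' i.-1; first arith.
    have edge : label_edge n (tile_level t') i by rewrite levt' /label_edge; arith.
    case/negP: (noar _ t'Q edge).
    rewrite /tile_left; apply/andP; split.
      by apply/eqP => e; move: levt levt'; rewrite e; arith.
    apply/exists_inP; exists s' => //; apply/exists_inP; exists s => //.
    have := forced_left bc tilr t'Q tQ leni levt' levt st' st levs' levs.
    by move: levs levs'; rewrite /square_left /level => e1 e2 le2; apply/orP; right; arith.
  split=> //; suff <- : t = left_tile n N (mem c) i by [].
  rewrite -levt; apply: leading_tileE; first exact: tiling_ribbon tilr tQ.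
  move=> s st; apply/negPn/negP => nls; have sR := tiling_sub tilr tQ st.
  have [q lq levq] := exists_leading n_gt0 sR.
  have [t' t'Q qt'] := tiling_cover tilr (leading_region lq).
  have le2 := leading_max lq sR (esym levq).
  have ne2 : (s.2 : nat) != q.2.
    by apply: contra nls => /eqP e; rewrite (square_inj (esym levq) e).
  have [levt'1 _ injt' _] := ribbon_tileP n_gt0 (tiling_ribbon tilr t'Q).
  have nett' : t' != t.
    by apply/eqP => e; rewrite e in qt' injt'; move: ne2; rewrite (injt' s q) ?eqxx.
  have edge : label_edge n (tile_level t') i.
    have := levt'1 _ qt'; have := levt1 _ st; rewrite levq levt => l1 l2.
    have ne : tile_level t' != i.
      by apply: contra nett' => /eqP e; apply/eqP/(label_inj n_gt0 bc tilr) => //; rewrite e levt.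
    by rewrite /label_edge ne; arith.
  case/negP: (noar _ t'Q edge).
  rewrite /tile_left nett'; apply/exists_inP; exists q => //; apply/exists_inP; exists s => //.
  rewrite /square_left levq eqxx; apply/orP; left; move: levq le2 ne2; rewrite /level.
  by clear; case: s => [x y]; case: q => [x' y'] /=; lia.
have [nci _] := andP Mi; rewrite nci; split=> //; apply/hasPn => j _; apply/negP.
case/andP=> ncj /andP[/and3P[neji _ _] /exists_inP[t tP /exists_inP[t' t'P]]].
case/and3P=> /eqP levt /eqP levt' /andP[nett' /exists_inP[s st /exists_inP[s' st' lft]]].
have eqt' : t' = left_tile n N (mem c) i.
  apply: (label_inj n_gt0 bpred0 tilP0) => //; first by move: tiQ; rewrite inE => /andP[].
  by rewrite levt' left_tile_level.
have tQ : t \in rest P c by rewrite inE tP levt.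
rewrite eqt' in st' nett'.
by have /negP[] := left_tile_not_right dc bc tilr Mi ltiN tiQ tQ nett' st st'.
Qed.

Lemma take_sources v : (take 1 (sources P c) == [:: v]) =
  source (mem c) (rest P c) v && no_source (mem c) v (rest P c).
Proof.
rewrite head_sortedP; last by apply: sorted_filter; [apply: ltn_trans|apply: iota_ltn_sorted].
rewrite mem_sources; congr (_ && _); apply/allP/(no_sourceP n_gt0) => [h i ltiv|h i].
  by apply/negP; rewrite -mem_sources => /h; rewrite leqNgt ltiv.
by rewrite mem_sources; apply: contraTT; rewrite -ltnNge => /h.
Qed.

Lemma rest_rcons v : source (mem c) (rest P c) v ->
  rest P (rcons c v) = rest P c :\ left_tile n N (mem c) v.
Proof.
move=> /and3P[/andP[ncv _] ltvN tQ]; apply/setP => t; rewrite in_setD1 !inE mem_rcons in_cons.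
rewrite negb_or andbCA; case tP: (t \in P); rewrite ?andbF //=; congr (~~ _ && _).
apply/eqP/eqP => [levt|->]; last by rewrite left_tile_level.
apply: (label_inj n_gt0 bpred0 tilP0) => //; first by move: tQ; rewrite inE => /andP[].
by rewrite levt left_tile_level.
Qed.

Lemma residual_covered : ~: covered_by c P = region n N (mem c).
Proof.
have [/and3P[/eqP cov _ _] _] := andP tilr.
apply/setP => s; rewrite in_setC; apply/idP/idP => [ns|sR].
  have [t tP st] : exists2 t, t \in P & s \in t by apply: (tiling_cover tilP); rewrite inE.
  rewrite -cov; apply/bigcupP; exists t; rewrite // inE tP /=.
  by apply: contra ns => tc; apply/bigcupP; exists t; rewrite ?tP.
have [t tQ st] := tiling_cover tilr sR; have := tQ; rewrite inE => /andP[tP ntc].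
apply/negP => /bigcupP[t' /andP[t'P t'c] st'].
by move: ntc; rewrite (tiling_uniq tilP tP t'P st st') t'c.
Qed.

End Prefix.

End FullTiling.

End TilingSequences.

(** * Tiling sequences *)

Section Words.

Variables n N : nat.
Hypothesis n_gt0 : 0 < n.
Implicit Types (S : pred nat) (P Q : {set {set square n N}}) (c w J : seq nat).

Lemma down_closed_ext S S' : S =1 S' -> down_closed n S -> down_closed n S'.
Proof. by move=> eqS dcS i; rewrite -!eqS; apply: dcS. Qed.

Lemma bounded_ext S S' : S =1 S' -> bounded N S -> bounded N S'.
Proof. by move=> eqS bS i; rewrite -eqS; apply: bS. Qed.

Lemma no_source_ext S S' b P : S =1 S' -> no_source S b P = no_source S' b P.
Proof. by move=> eqS; apply: eq_forallb => i; rewrite (source_ext P eqS). Qed.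

(** The upper half of [frontier_after]: closeness from the last chosen label on. When that label is
    0, it gives connectedness. *)
Definition frontier_from S v := minimal_free n S (v + n) /\
  forall x, minimal_free n S x -> v <= x -> not_last n S x -> close_next n S x.

Lemma frontier_from_ext S S' v : S =1 S' -> frontier_from S v -> frontier_from S' v.
Proof.
move=> eqS; have eqM := minimal_free_ext n eqS.
move=> [Mv cl]; split; first by rewrite -eqM.
move=> x; rewrite -eqM => Mx levx [y]; rewrite -eqM => My ltxy.
have [|z Mz ltz] := cl _ Mx levx; first by exists y.
by exists z; rewrite -?eqM.
Qed.

Lemma prefix_rconsP c v P k :
  prefix (rcons c v) (iter k (fun c => c ++ take 1 (sources P c)) [::]) ->
  take 1 (sources P c) = [:: v].
Proof.
elim: k => [|k IH] /=; first by case: c.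
case E: (take 1 _) => [|h [|h' r]]; last 1 first.
- by have := size_take 1 (sources P (iter k (fun c => c ++ take 1 (sources P c)) [::]));
  rewrite E; case: ifP => //=; case: (size _) => [|[]].
- by rewrite cats0.
rewrite cats1 => /prefixP[s']; case/lastP: s' => [|s' x].
  by rewrite cats0 => /rcons_inj[<- <-].
by rewrite -rcons_cat => /rcons_inj[e _]; apply: IH; apply/prefixP; exists s'.
Qed.

Definition good_prefix P J := [/\ uniq J, down_closed n (mem J), bounded N (mem J)
  & ribbon_tiling (region n N (mem J)) (rest P J)].

(** Along a tiling sequence a label lies less than [n] below its predecessor, if below at all, which
    is what [close_next_add] needs to propagate closeness. *)
Lemma prefix_tiling_sequence P J : ribbon_tiling [set: square n N] P ->
  prefix J (tiling_sequence P) -> good_prefix P J /\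
  forall c v, J = rcons c v ->
  [/\ good_prefix P c, source (mem c) (rest P c) v, no_source (mem c) v (rest P c) & frontier_from (mem J) v].
Proof.
move=> tilP; elim/last_ind: J => [|c v IH] pre.
  split; last by case.
  split=> //; rewrite rest_nil; suff -> : region n N (mem [::]) = setT by [].
  by rewrite -(region0 N n_gt0); apply: (@region_ext n N (mem [::]) pred0).
have [[uc dcc bc tilr] IHc] := IH (prefix_trans (prefix_rcons _ _) pre).
have /eqP := prefix_rconsP pre; rewrite take_sources // => /andP[srcv nos].
have /and3P[Mv ltvN tv] := srcv; have [ncv _] := andP Mv.
have eqS := mem_rcons_label c v.
have eqS' : add_label (mem c) v =1 mem (rcons c v) by move=> i; rewrite eqS.
split; first split.
- by rewrite rcons_uniq ncv uc.
- exact: down_closed_ext eqS' (down_closed_add n_gt0 dcc Mv).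
- exact: bounded_ext eqS' (bounded_add bc ltvN).
- by rewrite rest_rcons // (region_ext n N eqS); apply: tiling_remove.
move=> c0 v0 /rcons_inj[<- <-]; split=> //.
apply: (frontier_from_ext eqS'); split.
  by rewrite minimal_free_add // eqxx.
case/lastP: c {pre IH eqS eqS'} IHc uc dcc bc tilr srcv nos Mv tv ncv =>
  [|c u] IHc uc dcc bc tilr srcv nos Mv tv ncv.
  (* At the start the minimal labels are 0 to [n - 1]; the greatest serves as [w]. *)
  have M0 i : minimal_free n (mem [::]) i = (i < n) by rewrite /minimal_free /= orbF.
  rewrite M0 in Mv; apply: (@close_next_add n n_gt0 _ v n.-1) => //; rewrite ?M0; try arith.
  move=> x; rewrite M0 => ltx _ [y]; rewrite M0 => lty ltxy.
  by exists x.+1; rewrite ?M0; arith.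
have [[_ dcc' bc' tilr'] srcu nosu [Mu cl]] := IHc _ _ erefl.
apply: (close_next_add n_gt0 dcc Mv Mu); last first.
  by move=> x Mx; rewrite leq_add2r; apply: cl.
rewrite ltn_add2r ltn_neqAle; apply/andP; split.
  by apply: contra ncv => /eqP e; apply: dcc; rewrite -e /= mem_rcons mem_head.
(* If [v + n < u], then [v] was a source already when [u] was chosen, and a smaller one. *)
rewrite leqNgt; apply/negP => lt.
have /and3P[Mu' ltuN tu] := srcu.
have eqS' : mem (rcons c u) =1 add_label (mem c) u by apply: mem_rcons_label.
move: srcv; rewrite (source_ext _ eqS') rest_rcons // source_remove // => srcv.
by have /negP[] := no_sourceP n_gt0 _ _ _ nosu v ltac:(arith).
Qed.

Lemma residual_regionE J : initial_segment n N J ->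
  residual_region n N J = region n N (mem J).
Proof.
move=> [P0 bP0]; rewrite /residual_region; case: pickP => [P|/(_ P0)]; last by rewrite bP0.
move=> /andP[tilP pre]; have [[_ _ _ tilr] _] := prefix_tiling_sequence tilP pre.
exact: residual_covered.
Qed.

(** The local rule of tiling sequences: each label is minimal when chosen and at most [n] below its
    predecessor [b]. *)
Fixpoint valid_word c b w := if w is v :: r then
  [&& minimal_free n (mem c) v, v < N, b <= v + n & valid_word (rcons c v) v r] else true.

Fixpoint word_tiling c w : {set {set square n N}} := if w is v :: r then
  left_tile n N (mem c) v |: word_tiling (rcons c v) r else set0.

(** Tiles are put back from the last to the first. The rule [b <= v + n] places the threshold
    [b - n] at or below [v], and [insert_source] leaves no source below [v]. *)
Lemma word_tilingP c b w : down_closed n (mem c) -> bounded N (mem c) ->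
  valid_word c b w -> (forall i, i < N -> i \in c ++ w) ->
  [/\ ribbon_tiling (region n N (mem c)) (word_tiling c w),
      no_source (mem c) (b - n) (word_tiling c w)
    & forall v r, w = v :: r -> source (mem c) (word_tiling c w) v
        && no_source (mem c) v (word_tiling c w)].
Proof.
elim: w c b => [|v w IH] c b dcc bc /=.
  rewrite cats0 => _ full; rewrite region_full ?tiling_set0 ?eqxx //; split=> //.
  by apply/(no_sourceP n_gt0) => i _; apply/negP => /and3P[/andP[/negP nci _] /full].
case/and4P=> Mv ltvN lebv val full; have [ncv _] := andP Mv.
have eqS : mem (rcons c v) =1 add_label (mem c) v by apply: mem_rcons_label.
have eqS' : add_label (mem c) v =1 mem (rcons c v) by move=> i; rewrite eqS.
have [||||til nos _] := IH (rcons c v) v => //.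
- exact: down_closed_ext eqS' (down_closed_add n_gt0 dcc Mv).
- exact: bounded_ext eqS' (bounded_add bc ltvN).
- by move=> i /full; rewrite cat_rcons.
rewrite (region_ext n N eqS) in til; rewrite (no_source_ext _ _ eqS) in nos.
have [tilP srcv nosv] := insert_source n_gt0 dcc bc Mv ltvN til nos.
split=> // [|_ _ [<- _]]; last by rewrite srcv.
by apply/(no_sourceP n_gt0) => i lti; apply: (no_sourceP n_gt0 _ _ _ nosv); arith.
Qed.

Lemma tiling_sequence_word w : valid_word [::] 0 w -> size w = N ->
  (forall i, i < N -> i \in w) ->
  ribbon_tiling [set: square n N] (word_tiling [::] w) /\
  tiling_sequence (word_tiling [::] w) = w.
Proof.
move=> val sz full; set P := word_tiling [::] w.
have tilP : ribbon_tiling [set: square n N] P.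
  have dc0 : down_closed n (mem (Nil nat)) by [].
  have b0 : bounded N (mem (Nil nat)) by [].
  have [til _ _] := word_tilingP dc0 b0 val full.
  by move: til; rewrite -(region0 N n_gt0) (@region_ext n N (mem [::]) pred0).
split=> //; rewrite /tiling_sequence; set f := fun c => _.
(* Invariant: after [k] steps the remaining tiles are the word tiling of the remaining word. *)
suff H k : k <= N -> iter k f [::] = take k w /\ [/\ down_closed n (mem (take k w)),
    bounded N (mem (take k w)), exists b, valid_word (take k w) b (drop k w)
    & rest P (take k w) = word_tiling (take k w) (drop k w)].
  by have [] := H N (leqnn N); rewrite -{2}sz take_size.
elim: k => [|k IH] ltk.
  rewrite take0 drop0; split=> //; split=> //; first by exists 0.
  by rewrite rest_nil.
have [it [dcc bc [b]]] := IH (ltnW ltk); rewrite -sz in ltk.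
have := cat_take_drop k w; rewrite (take_nth 0 ltk) (drop_nth 0 ltk).
move: (take k w) (nth 0 w k) (drop k.+1 w) it dcc bc => c v r it dcc bc ew valv restc.
have := valv => /= /and4P[Mv ltvN lebv val'].
have [|til _ /(_ _ _ erefl)] := word_tilingP dcc bc valv; first by rewrite ew.
rewrite -restc in til *; rewrite -take_sources // => /eqP src.
have eqS : add_label (mem c) v =1 mem (rcons c v) by move=> i; rewrite (mem_rcons_label c v i).
split; first by rewrite /= it /f src cats1.
split.
- exact: down_closed_ext eqS (down_closed_add n_gt0 dcc Mv).
- exact: bounded_ext eqS (bounded_add bc ltvN).
- by exists v.
move/eqP: src; rewrite take_sources // => /andP[srcv _].
rewrite rest_rcons // restc /= setU1K // left_tile_notin //; first by case/andP: Mv.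
rewrite (region_ext n N eqS).
have [||||til' _ _] := @word_tilingP (rcons c v) v r => //.
- exact: down_closed_ext eqS (down_closed_add n_gt0 dcc Mv).
- exact: bounded_ext eqS (bounded_add bc ltvN).
- by move=> i; rewrite cat_rcons ew; apply: full.
Qed.

Lemma full_columnsE J d : initial_segment n N J -> down_closed n (mem J) ->
  (forall i, i < d -> i \in J) -> d \notin J -> d <= N -> full_columns n N J = d.
Proof.
move=> inJ dcJ Jd nJd ledN; rewrite /full_columns residual_regionE //.
transitivity #|[set x : 'I_N | x < d]|.
  apply: eq_card => x; rewrite !inE; apply/forallP/idP => [/(_ (Ordinal n_gt0))|ltxd y].
    apply: contraTT; rewrite -leqNgt inE /= negbK /level /= addn0 => ledx.
    (* A column [x >= d] keeps its bottom square: the window at level [x] contains a label congruent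
       to [d] and not below it, which is free by down-closure. *)
    apply/(width_gt0P n); exists (d + n * ((x - d) %/ n)).
      elim: (_ %/ n) => [|k IH]; first by rewrite muln0 addn0.
      by apply: contra IH; rewrite mulnS addnCA addnC => /dcJ.
    have e := divn_eq (x - d) n; have := ltn_pmod (x - d) n_gt0.
    by rewrite mulnC; move: e; move: (_ %/ n * n) (_ %% n) => a b; clear -ledx; arith.
  rewrite inE -leqNgt /level /=.
  (* All labels below [d] are chosen, so for [x < d] at most [y] free ones remain in the window. *)
  have : width n (mem J) (x + y) <= count (fun k => (0 <= k) && (k < (x + y).+1 - d)) (iota 0 n).
    apply: sub_count => k /= /andP[lek nJ].
    by case: (ltnP (x + y - k) d) => [/Jd|]; [rewrite (negbTE nJ)|arith].
  by rewrite count_iota_interval => le; apply: leq_trans le _; arith.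
rewrite cardsE cardE /enum_mem size_filter -enumT -(count_map val (fun x => x < d)) val_enum_ord.
by rewrite (count_iota_interval 0 d N); arith.
Qed.

End Words.

(** * Fundamental sequences *)

Section Normalization.

Implicit Types K : seq nat.

Lemma mem_delta_zeta0 K i : uniq K -> (i \in delta (zeta0 K)) = (i.+1 \in K).
Proof.
move=> uK; rewrite /delta /zeta0 /=; apply/mapP/idP => [[j]|iK].
  by rewrite mem_rem_uniq // inE => /andP[j0 jK] ->; rewrite prednK // lt0n.
by exists i.+1; rewrite // mem_rem_uniq // inE.
Qed.

Lemma iter_delta d K : uniq K ->
  [/\ uniq (iter d (fun K => delta (zeta0 K)) K),
      forall i, (i \in iter d (fun K => delta (zeta0 K)) K) = (i + d \in K)
    & (forall i, i < d -> i \in K) -> size (iter d (fun K => delta (zeta0 K)) K) + d = size K].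
Proof.
move=> uK; elim: d => [|d [u mem sz]]; first by split=> // [i|_]; rewrite addn0.
rewrite iterS; set K' := iter d _ K in u mem sz *; split.
- rewrite /delta /= map_inj_in_uniq ?rem_uniq // => x y.
  by rewrite !mem_rem_uniq // !inE => /andP[x0 _] /andP[y0 _]; lia.
- by move=> i; rewrite mem_delta_zeta0 // mem addSnnS.
- move=> Kd; rewrite /delta /= size_map size_rem; last by rewrite mem Kd.
  have -> : size K = size K' + d by rewrite sz // => i lti; apply: Kd; lia.
  have : 0 < size K' by rewrite -has_predT; apply/hasP; exists 0; rewrite // mem Kd.
  by case: (size K') => // m _; rewrite addSnnS.
Qed.

Definition mex K := find (fun i => i \notin K) (iota 0 (\max_(x <- K) x).+2).

Lemma mexP K : (forall i, i < mex K -> i \in K) /\ mex K \notin K.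
Proof.
have hasn : has (fun i => i \notin K) (iota 0 (\max_(x <- K) x).+2).
  apply/hasP; exists (\max_(x <- K) x).+1; first by rewrite mem_iota; lia.
  by apply/negP => /(fun h => @leq_bigmax_seq _ K predT id _ h isT) /=; lia.
have lt := hasn; rewrite has_find size_iota in lt.
split; last by have := nth_find 0 hasn; rewrite nth_iota.
move=> i lti; have := before_find 0 lti; rewrite nth_iota ?add0n; last exact: ltn_trans lt.
by move/negbFE.
Qed.

Lemma mex_unique K d : (forall i, i < d -> i \in K) -> d \notin K -> mex K = d.
Proof.
move=> Kd nKd; have [Km nKm] := mexP K.
by case: (ltngtP (mex K) d) => // [/Kd|/Km]; [rewrite (negbTE nKm)|rewrite (negbTE nKd)].
Qed.

(** [phi] freed from the strip: for the segments in question [full_columnsE] identifies the number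
    of full columns with [mex]. *)
Definition reduced K := sort leq (iter (mex K) (fun K => delta (zeta0 K)) K).

Lemma reduced_sorted K : uniq K -> sorted ltn (reduced K).
Proof.
move=> uK; rewrite ltn_sorted_uniq_leq sort_uniq; have [-> _ _] := iter_delta (mex K) uK.
exact: (sort_sorted leq_total).
Qed.

Lemma mem_reduced K i : uniq K -> (i \in reduced K) = (i + mex K \in K).
Proof. by move=> uK; rewrite mem_sort; have [_ -> _] := iter_delta (mex K) uK. Qed.

Lemma size_reduced K : uniq K -> size (reduced K) + mex K = size K.
Proof.
move=> uK; rewrite size_sort; have [_ _ -> //] := iter_delta (mex K) uK.
by have [] := mexP K.
Qed.

End Normalization.

(** * Minimal labels of a finite set and front states *)

Section FrontStates.

Variable n : nat.
Implicit Types (S : pred nat) (F G K l w c : seq nat).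

Local Notation M := (minimal_free n).

Lemma down_closed_iter S k i : down_closed n S -> S (i + k * n) -> S i.
Proof.
move=> dcS; elim: k => [|k IH]; first by rewrite addn0.
by rewrite mulSn addnCA addnC => /dcS.
Qed.

Lemma minimal_free_modn_inj S x y : down_closed n S -> M S x -> M S y ->
  x = y %[mod n] -> x = y.
Proof.
move=> dcS; wlog ltxy : x y / x < y.
  by move=> H Mx My e; case: (ltngtP x y) => // lt; [apply: H|symmetry; apply: H].
move=> /andP[nSx _] /andP[_ oSy] e; case/negP: nSx.
have /dvdnP[k ek] : n %| y - x by rewrite -eqn_mod_dvd ?(ltnW ltxy) //; apply/eqP.
case: k ek => [|k] ek; first lia.
have ey : y = x + k * n + n by rewrite -addnA -mulSnr -ek; lia.
apply: (@down_closed_iter _ k) => //; move: oSy; rewrite ey addnK => /orP[|//]; lia.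
Qed.

(** Exceeds all elements of [F] by more than [n], hence also every minimal label. *)
Definition label_bound F := n + (\max_(x <- F) x).+1.

Lemma mem_label_bound F x : x \in F -> x + n < label_bound F.
Proof. by move=> xF; have := @leq_bigmax_seq _ F predT id x xF isT; rewrite /label_bound /=;
  lia. Qed.

Lemma minimal_free_bound F x : M (mem F) x -> x < label_bound F.
Proof.
move=> /andP[_ /orP[ltx|/mem_label_bound]]; rewrite /label_bound; lia.
Qed.

Definition minimal_labels F := [seq x <- iota 0 (label_bound F) | M (mem F) x].

Lemma mem_minimal_labels F x : (x \in minimal_labels F) = M (mem F) x.
Proof.
rewrite mem_filter mem_iota; case Mx: (M _ _) => //=.
exact: minimal_free_bound.
Qed.

Lemma minimal_labels_sorted F : sorted ltn (minimal_labels F).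
Proof. by apply: sorted_filter; [apply: ltn_trans|apply: iota_ltn_sorted]. Qed.

Hypothesis n_gt0 : 0 < n.

Lemma minimal_labels_perm F : down_closed n (mem F) ->
  perm_eq (map (modn^~ n) (minimal_labels F)) (iota 0 n).
Proof.
move=> dcF; apply: uniq_perm; last 1 first.
- move=> r; rewrite mem_iota /= add0n; apply/mapP/idP => [[x _ ->]|ltr].
    by rewrite ltn_mod.
  have exk : exists k, r + k * n \notin F.
    exists (label_bound F); apply/negP => /mem_label_bound.
    by have := leq_pmulr (label_bound F) n_gt0; lia.
  case: (ex_minnP exk) => k nk mink; exists (r + k * n); last by rewrite addnC modnMDl modn_small.
  rewrite mem_minimal_labels /minimal_free nk /=.
  case: k nk mink => [|k] nk mink; first by rewrite addn0 ltr.
  rewrite mulSnr addnA addnK; apply/orP; right; apply/negPn/negP => /mink; lia.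
- rewrite map_inj_in_uniq ?(sorted_uniq ltn_trans ltnn) ?minimal_labels_sorted //.
  by move=> x y; rewrite !mem_minimal_labels => Mx My; apply: minimal_free_modn_inj dcF Mx My.
- exact: iota_uniq.
Qed.

Lemma size_minimal_labels F : down_closed n (mem F) -> size (minimal_labels F) = n.
Proof. by move=> /minimal_labels_perm/perm_size; rewrite size_map size_iota. Qed.

(** The intrinsic description of fundamental sequences; [fundamentalP] proves the equivalence. *)
Definition front_state F :=
  [/\ sorted ltn F, 0 \notin F, down_closed n (mem F) & connected n (mem F)].

Lemma minimal_free_shift d S x : (forall i, i < d -> S i) ->
  M (shift_labels d S) x = M S (x + d).
Proof.
move=> Sd; rewrite /minimal_free /shift_labels; congr (_ && _).
have [lt|le] /= := ltnP x n.
  case: (ltnP (x + d) n) => //= le; rewrite Sd //; lia.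
by rewrite addnBAC // ltnNge (leq_trans le) ?leq_addr.
Qed.

Lemma connected_shift d S : (forall i, i < d -> S i) -> connected n S ->
  connected n (shift_labels d S).
Proof.
move=> Sd con x; rewrite minimal_free_shift // => Mx [y]; rewrite minimal_free_shift // => My ltxy.
have [|z Mz ltz] := con _ Mx; first by exists (y + d); rewrite ?ltn_add2r.
by exists (z - d); rewrite ?minimal_free_shift ?subnK //; lia.
Qed.

Lemma down_closed_shift d S : down_closed n S -> down_closed n (shift_labels d S).
Proof. by move=> dcS i; rewrite /shift_labels addnAC => /dcS. Qed.

Lemma connected_ext S S' : S =1 S' -> connected n S -> connected n S'.
Proof.
move=> eqS con x; have eqM := minimal_free_ext n eqS; rewrite -eqM => Mx [y]; rewrite -eqM => My lt.
by have [|z Mz ltz] := con _ Mx; [exists y|exists z; rewrite -?eqM].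
Qed.

Lemma reduced_state K : uniq K -> down_closed n (mem K) -> connected n (mem K) ->
  front_state (reduced K).
Proof.
move=> uK dcK con; have [Km nKm] := mexP K.
have eqS : shift_labels (mex K) (mem K) =1 mem (reduced K).
  by move=> i; rewrite /= mem_reduced.
split; first exact: reduced_sorted.
- by rewrite mem_reduced.
- by apply: (down_closed_ext eqS); apply: down_closed_shift.
- by apply: (connected_ext eqS); apply: connected_shift.
Qed.

Lemma fundamental_state F : fundamental n F -> front_state F.
Proof.
move=> [N [J [iniK ->]]]; set K := rcons J 0 in iniK *.
have [P /andP[tilP pre]] := iniK.
have [[uK dcK bK _] /(_ _ _ erefl)[_ _ _ [_ cl]]] := prefix_tiling_sequence n_gt0 tilP pre.
have [Km nKm] := mexP K.
have ledN : mex K <= N.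
  by rewrite leqNgt; apply/negP => /Km /bK; rewrite ltnn.
rewrite /phi (full_columnsE n_gt0 iniK dcK Km nKm ledN) -/(reduced K).
(* The last label is 0, so closeness from it on covers all minimal labels. *)
by apply: reduced_state => // x Mx; apply: cl.
Qed.

Lemma valid_word_cat N c b w w' : valid_word n N c b (w ++ w') =
  valid_word n N c b w && valid_word n N (c ++ w) (last b w) w'.
Proof.
elim: w c b => [|v w IH] c b /=; first by rewrite cats0.
by rewrite IH cat_rcons !andbA.
Qed.

Lemma valid_word_ascending N c b w : sorted ltn w -> (forall i, i \in w -> i < N) ->
  (forall i, i \in w -> i \notin c) -> (forall i, i \in w -> b <= i + n) ->
  (forall i, i \in w -> n <= i -> (i - n \in c) || (i - n \in w)) ->
  valid_word n N c b w.
Proof.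
elim: w c b => //= v w IH c b sw ltN nc lb dc.
have gtv : {in w, forall x, v < x}.
  by apply/allP/(order_path_min _ sw); apply: ltn_trans.
rewrite ltN ?lb ?mem_head //= /minimal_free /= nc ?mem_head //=.
have -> /= : (v < n) || (v - n \in c).
  case: (ltnP v n) => //= le; have := dc v (mem_head _ _) le; rewrite in_cons.
  by case/or3P=> // [/eqP|/gtv]; lia.
apply: IH => [|i iw|i iw|i iw|i iw le].
- exact: path_sorted sw.
- by apply: ltN; rewrite in_cons iw orbT.
- rewrite mem_rcons in_cons negb_or nc ?in_cons ?iw ?orbT // andbT.
  by have := gtv _ iw; lia.
- by have := gtv _ iw; lia.
- have := dc i; rewrite !in_cons iw orbT => /(_ isT le).
  by rewrite mem_rcons in_cons; case/or3P=> ->; rewrite ?orbT.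
Qed.

Lemma valid_word_minimal N c b w : down_closed n (mem c) ->
  (forall i, i \in w -> M (mem c) i && (i < N)) -> uniq w ->
  path (fun u v => u <= v + n) b w -> valid_word n N c b w.
Proof.
elim: w c b => //= v w IH c b dcc Mw /andP[nvw uw] /andP[-> pw].
have /andP[Mv ->] := Mw _ (mem_head _ _); rewrite Mv /=.
have eqS : add_label (mem c) v =1 mem (rcons c v) by move=> i; rewrite (mem_rcons_label c v i).
apply: IH => //; first exact: down_closed_ext eqS (down_closed_add n_gt0 dcc Mv).
move=> i iw; have /andP[Mi ->] : M (mem c) i && (i < N) by rewrite Mw // in_cons iw orbT.
rewrite andbT.
rewrite -(minimal_free_ext n eqS) minimal_free_add // Mi andbT orbC.
by apply/orP; left; apply: contraNneq nvw => <-.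
Qed.

End FrontStates.

(** * Realizing front states by tiling sequences *)

Section StateWords.

Variable n : nat.
Hypothesis n_gt0 : 0 < n.
Implicit Types (F K l : seq nat).

Local Notation M := (minimal_free n).

Lemma ltn_sorted_eq (s s' : seq nat) : sorted ltn s -> sorted ltn s' -> s =i s' -> s = s'.
Proof. exact: irr_sorted_eq ltn_trans ltnn _ _. Qed.

Section State.

Variable F : seq nat.
Hypothesis frF : front_state n F.

Let uF : uniq F. Proof. by have [sF _ _ _] := frF; apply: (sorted_uniq ltn_trans ltnn). Qed.

Lemma minimal_free0 : M (mem F) 0.
Proof. by have [_ nF _ _] := frF; rewrite /minimal_free /= nF n_gt0. Qed.

Lemma minimal_labels_behead : minimal_labels n F = 0 :: behead (minimal_labels n F).
Proof.
rewrite /minimal_labels; case E: (label_bound n F) => [|b].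
  by move: E; rewrite /label_bound addnS.
by rewrite /= minimal_free0.
Qed.

Lemma exists_minimal_above x : x \in F ->
  exists2 m, m \in minimal_labels n F & x < m /\ x = m %[mod n].
Proof.
move=> xF; have [_ _ dcF _] := frF.
have : x %% n \in map (modn^~ n) (minimal_labels n F).
  by rewrite (perm_mem (minimal_labels_perm n_gt0 dcF)) mem_iota /= ltn_mod.
case/mapP=> m mM e; exists m => //; split=> //; rewrite ltnNge; apply/negP => lemx.
move: mM; rewrite mem_minimal_labels => /andP[/negP nm _]; apply: nm.
have /dvdnP[k ek] : n %| x - m by rewrite -eqn_mod_dvd //; apply/eqP.
by apply: (@down_closed_iter n _ k) => //=; rewrite -ek subnKC.
Qed.

Lemma minimal_labels_gaps : sorted (fun u v => u < v < u + n) (minimal_labels n F).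
Proof.
have [_ _ _ con] := frF; have sM := minimal_labels_sorted n F.
apply/(sortedP 0) => i lti; set m := minimal_labels n F in sM lti *.
have lt1 : nth 0 m i < nth 0 m i.+1 by apply: (sortedP 0 sM).
have mi : nth 0 m i \in m by apply/mem_nth/ltnW.
have mi1 : nth 0 m i.+1 \in m by apply: mem_nth.
have [||y My /andP[lt2 lt3]] := con (nth 0 m i); rewrite -?mem_minimal_labels //.
  by exists (nth 0 m i.+1); rewrite -?mem_minimal_labels.
rewrite -mem_minimal_labels -/m in My.
have mono := sorted_leq_nth leq_trans leqnn 0 (sub_sorted ltnW sM).
have /(nthP 0)[j ltj ej] := My; rewrite lt1 /=.
apply: leq_ltn_trans lt3; rewrite -ej.
apply: (mono); rewrite ?inE //; rewrite ltnNge; apply/negP => leji.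
by have := mono j i ltj (ltnW lti) leji; rewrite ej leqNgt lt2.
Qed.

(** Appending all minimal labels in descending order makes the word end in 0. Its elements are the
    labels below [n] and those of [F] shifted by [n], so reducing it gives back [F]. *)
Definition state_word := F ++ rev (minimal_labels n F).

Lemma mem_state_word i : (i \in state_word) = (i \in F) || M (mem F) i.
Proof. by rewrite mem_cat mem_rev mem_minimal_labels. Qed.

Lemma state_word_uniq : uniq state_word.
Proof.
rewrite cat_uniq uF rev_uniq (sorted_uniq ltn_trans ltnn) ?minimal_labels_sorted // andbT.
apply/hasPn => x; rewrite mem_rev mem_minimal_labels => /andP[nx _]; exact: nx.
Qed.

Lemma state_word_down_closed : down_closed n (mem state_word).
Proof.
have [_ _ dcF _] := frF; move=> i; rewrite /= !mem_state_word => /orP[/dcF /= ->//|/andP[_]].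
by rewrite addnK => /orP[|/= -> //]; lia.
Qed.

Lemma state_word_bound i : i \in state_word -> i < label_bound n F.
Proof.
by rewrite mem_state_word => /orP[/(mem_label_bound n)|/minimal_free_bound //]; lia.
Qed.

Lemma state_word_tiling N : label_bound n F <= N -> exists2 P,
  ribbon_tiling [set: square n N] P &
  tiling_sequence P = state_word ++ [seq i <- iota 0 N | i \notin state_word].
Proof.
move=> leBN; have [sF nF dcF con] := frF; set r := [seq i <- _ | _].
have memr i : (i \in r) = (i < N) && (i \notin state_word).
  by rewrite mem_filter mem_iota /= andbC.
have full i : i < N -> i \in state_word ++ r.
  by move=> lti; rewrite mem_cat memr lti /= orbN.
have bnd i : i \in state_word -> i < N by move/state_word_bound => /leq_trans; apply.
have [|||til ts] := @tiling_sequence_word n N n_gt0 (state_word ++ r);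
  last by exists (word_tiling n N [::] (state_word ++ r)).
- rewrite valid_word_cat; apply/andP; split; last first.
    have -> : last 0 state_word = 0.
      by rewrite last_cat minimal_labels_behead rev_cons last_rcons.
    apply: valid_word_ascending => // [|i|i|i].
    + by apply: sorted_filter; [apply: ltn_trans|apply: iota_ltn_sorted].
    + by rewrite memr => /andP[].
    + by rewrite memr => /andP[].
    + rewrite !memr => /andP[ltiN _] _; case: (_ \in state_word) => //=; lia.
  rewrite valid_word_cat; apply/andP; split.
    apply: valid_word_ascending => // i iF.
      by apply: bnd; rewrite mem_state_word iF.
    by move=> le; apply/orP; right; apply: dcF; rewrite /= subnK.
  apply: valid_word_minimal => // [i||].
  + by rewrite mem_rev mem_minimal_labels => Mi; rewrite Mi bnd // mem_state_word Mi orbT.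
  + by have := state_word_uniq; rewrite cat_uniq => /and3P[].
  have srt : sorted (fun u v => u <= v + n) (rev (minimal_labels n F)).
    rewrite rev_sorted; apply: sub_sorted minimal_labels_gaps.
    by move=> u v /= /andP[_ /ltnW].
  have top x : x \in F -> exists2 m, m \in rev (minimal_labels n F) & x < m.
    by move/exists_minimal_above => [m mM [lt _]]; exists m; rewrite ?mem_rev.
  have desc : sorted gtn (rev (minimal_labels n F)).
    by rewrite rev_sorted; apply: minimal_labels_sorted.
  case: (rev _) srt top desc => //= m rm -> top desc; rewrite andbT.
  (* At the junction, the last element of [F] lies below the greatest minimal label. *)
  case/lastP: (F) top => [|F' x] top; first by rewrite /=; lia.
  have [|m' m'M ltx] := top x; first by rewrite mem_rcons mem_head.
  rewrite last_rcons; move: m'M; rewrite in_cons => /orP[/eqP <-|m'r]; first lia.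
  have : m' < m.
    by apply: (allP (order_path_min _ desc)) m'r => a b c /= h1 h2; apply: ltn_trans h2 h1.
  lia.
- have /perm_size -> : perm_eq (state_word ++ r) (iota 0 N); last exact: size_iota.
  apply: uniq_perm; rewrite ?iota_uniq //.
    rewrite cat_uniq state_word_uniq filter_uniq ?iota_uniq // andbT.
    by apply/hasPn => i; rewrite memr => /andP[].
  move=> i; rewrite mem_cat memr mem_iota /= add0n.
  by case iw: (i \in state_word) => /=; rewrite ?andbT //; apply/esym; apply: bnd.
- exact: full.
Qed.

Lemma state_initial_segment N J J' : label_bound n F <= N -> state_word = J ++ J' ->
  initial_segment n N J.
Proof.
move=> leBN ew; have [P tilP ts] := state_word_tiling leBN.
by exists P; rewrite /begins_with tilP ts ew -catA prefix_prefix.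
Qed.

Lemma state_word_mex : mex state_word = n.
Proof.
have [_ nF dcF _] := frF; apply: mex_unique => [i lti|].
  by rewrite mem_state_word /minimal_free lti /= andbT orbN.
rewrite mem_state_word /minimal_free ltnn subnn /= (negbTE nF) andbF orbF.
by apply: contra nF => h; apply: dcF.
Qed.

Lemma state_word_reduced : reduced state_word = F.
Proof.
have [sF nF dcF _] := frF; have uw := state_word_uniq.
apply: ltn_sorted_eq => [||i]; [exact: reduced_sorted|exact: sF|].
rewrite mem_reduced // state_word_mex mem_state_word /minimal_free addnK.
have -> : i + n < n = false by lia.
rewrite /=; case: (boolP (i + n \in F)) => [h|_]; last by [].
by symmetry; exact: (dcF i h).
Qed.

Lemma state_fundamental : fundamental n F.
Proof.
pose J := F ++ rev (behead (minimal_labels n F)).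
have eJ : rcons J 0 = state_word.
  by rewrite /state_word minimal_labels_behead rev_cons /J rcons_cat.
have ini : initial_segment n (label_bound n F) (rcons J 0).
  by rewrite eJ; apply: (@state_initial_segment _ _ [::] (leqnn _)); rewrite cats0.
exists (label_bound n F), J; split=> //.
have [Km nKm] := mexP state_word.
rewrite /phi (full_columnsE n_gt0 ini (d := mex state_word)) ?eJ ?state_word_reduced //.
- by rewrite -/(reduced state_word) state_word_reduced.
- exact: state_word_down_closed.
- by rewrite state_word_mex /label_bound; lia.
Qed.

Lemma num_tilingsE k : label_bound n F <= k + size F ->
  num_tilings n F k = count_tilings n (k + size F) (mem F) 0.
Proof.
move=> leB; rewrite count_tilings0 // /num_tilings residual_regionE //.
exact: state_initial_segment leB erefl.
Qed.

End State.

Lemma fundamentalP F : fundamental n F <-> front_state n F.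
Proof. by split; [apply: fundamental_state|apply: state_fundamental]. Qed.

End StateWords.

(** * The recurrence *)

Lemma uniq_map_injective (T T' : eqType) (f : T -> T') (s : seq T) :
  uniq (map f s) -> {in s &, injective f}.
Proof.
elim: s => //= x s IH /andP[nfx us] y z; rewrite !in_cons.
case/predU1P=> [->|ys] /predU1P[->|zs] // e; last exact: IH.
  by rewrite e map_f in nfx.
by rewrite -e map_f in nfx.
Qed.

Section Recurrence.

Variable n : nat.
Hypothesis n_gt0 : 0 < n.
Implicit Types (F K l : seq nat).

Local Notation M := (minimal_free n).

Section State.

Variable F : seq nat.
Hypothesis frF : front_state n F.

Let dcF : down_closed n (mem F). Proof. by have [_ _ dc _] := frF. Qed.
Let conF : connected n (mem F). Proof. by have [_ _ _ con] := frF. Qed.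
Let uF : uniq F. Proof. by have [sF _ _ _] := frF; apply: (sorted_uniq ltn_trans ltnn). Qed.

Lemma word_down_closed l : {subset l <= minimal_labels n F} ->
  down_closed n (mem (F ++ l)).
Proof.
move=> sub i; rewrite /= !mem_cat => /orP[h|/sub].
  by apply/orP; left; apply: (dcF h).
rewrite mem_minimal_labels /minimal_free addnK => /andP[_ /orP[|h]]; first lia.
by apply/orP; left.
Qed.

Definition terms := recurrence_terms n (mem F) (label_bound n F).

Lemma terms_uniq : uniq (map snd terms).
Proof.
rewrite /terms /recurrence_terms map_allpairs /=.
rewrite -(allpairs_mapr (fun u l => u :: l) (fun u p => p.2) _
  (fun u => expansion n (label_bound n F) (add_label (mem F) u) u)).
apply: allpairs_uniq_dep; first by rewrite filter_uniq ?iota_uniq.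
  by move=> u _; apply: expansion_uniq.
by move=> [u l] [u' l'] _ _ /= [-> ->].
Qed.

Lemma terms_mem e l : (e, l) \in terms ->
  [/\ sorted gtn l, {subset l <= minimal_labels n F}, 0 < size l
    & connected n (add_labels (mem F) l)].
Proof.
case/allpairsPdep=> u [[e' l'] [uM inl [_ ->]]].
rewrite mem_filter in uM; have /andP[Mu _] := uM.
have fr := connected_pick n_gt0 dcF conF Mu.
have [/= pth al con] := expansion_mem n_gt0 fr inl; split=> // x.
rewrite in_cons mem_minimal_labels => /orP[/eqP->//|xl].
have gtu : {in l', forall x, x < u}.
  by apply/allP/(order_path_min _ pth) => a b c /= lt1 lt2; apply: ltn_trans lt2 lt1.
have := allP al x xl; rewrite minimal_free_add // => /orP[/eqP e1|/andP[]//].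
by have := gtu _ xl; lia.
Qed.

Lemma terms_size e l : (e, l) \in terms -> 0 < size l <= n.
Proof.
case/terms_mem=> sl sub -> _; rewrite -(size_minimal_labels n_gt0 dcF).
apply: uniq_leq_size sub; rewrite -rev_uniq; apply: (sorted_uniq ltn_trans ltnn).
by rewrite rev_sorted.
Qed.

Lemma terms_word_uniq e l : (e, l) \in terms -> uniq (F ++ l).
Proof.
case/terms_mem=> sl sub _ _; rewrite cat_uniq uF /=; apply/andP; split.
  by apply/hasPn => x /sub; rewrite mem_minimal_labels => /andP[].
by rewrite -rev_uniq; apply: (sorted_uniq ltn_trans ltnn); rewrite rev_sorted.
Qed.

(** Once the greatest minimal label [u] is chosen, nothing minimal is left in [[u, u + n)], so
    [expansion_all] applies. This term yields the block [I_2]. *)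
Lemma terms_all : (false, rev (minimal_labels n F)) \in terms.
Proof.
have M0 := minimal_free0 n_gt0 frF.
have exM : exists u, M (mem F) u by exists 0.
have [u Mu maxu] := ex_maxnP exM (fun i Mi => ltnW (minimal_free_bound Mi)).
have ltuB := minimal_free_bound Mu.
have fr := connected_pick n_gt0 dcF conF Mu.
apply/allpairsPdep; exists u, (false, rev [seq x <- iota 0 u | M (add_label (mem F) u) x]).
split; first by rewrite mem_filter Mu mem_iota.
  apply: expansion_all => // x; rewrite minimal_free_add // => /orP[/eqP->|/andP[nex Mx]].
    by rewrite leqnn orbT.
  by have := maxu _ Mx; lia.
congr (_, _); rewrite /minimal_labels.
have -> : iota 0 (label_bound n F) = iota 0 u ++ u :: iota u.+1 (label_bound n F - u.+1).
  by rewrite -[u :: _]/(iota u (label_bound n F - u.+1).+1) -iotaD; congr iota; lia.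
rewrite filter_cat /= Mu.
have -> : [seq x <- iota u.+1 (label_bound n F - u.+1) | M (mem F) x] = [::].
  apply/eqP; rewrite -[_ == _]negbK -has_filter; apply/hasPn => x.
  by rewrite mem_iota => inx; apply/negP => Mx; have := maxu _ Mx; lia.
rewrite cats1 rev_rcons; congr (_ :: rev _); apply: eq_in_filter => x.
rewrite mem_iota minimal_free_add // => inx.
by have [-> ->] : (x == u + n = false) /\ x != u by lia.
Qed.

Lemma terms_full e l : (e, l) \in terms -> size l = n ->
  (e, l) = (false, rev (minimal_labels n F)).
Proof.
move=> el sz; apply: (uniq_map_injective terms_uniq) => //; first exact: terms_all.
have [sl sub _ _] := terms_mem el; have /= := terms_word_uniq el.
rewrite cat_uniq => /and3P[_ _ ul].
have [|_ eqi] := uniq_min_size ul sub; first by rewrite size_minimal_labels // sz.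
rewrite /= -[LHS]revK; congr rev.
apply: ltn_sorted_eq; rewrite ?rev_sorted ?minimal_labels_sorted // => x.
by rewrite mem_rev eqi.
Qed.

(** Equal sizes force equal [mex] by [size_reduced], so the union with [F], and hence the set of
    picks, can be recovered. This keeps the matrix entries within 0, 1 and -1. *)
Lemma terms_reduced_inj e l e' l' : (e, l) \in terms -> (e', l') \in terms ->
  size l = size l' -> reduced (F ++ l) = reduced (F ++ l') -> (e, l) = (e', l').
Proof.
move=> el el' sz en; apply: (uniq_map_injective terms_uniq) => //=.
have [u u'] := (terms_word_uniq el, terms_word_uniq el').
have [[sl sub _ _] [sl' sub' _ _]] := (terms_mem el, terms_mem el').
have emex : mex (F ++ l) = mex (F ++ l').
  by have := size_reduced u; have := size_reduced u'; rewrite !size_cat en sz; lia.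
have eqi : F ++ l =i F ++ l'.
  move=> i; have [[K1 _] [K1' _]] := (mexP (F ++ l), mexP (F ++ l')).
  have [lt|le] := ltnP i (mex (F ++ l)); first by rewrite K1 // K1' // -emex.
  have := mem_reduced (i - mex (F ++ l)) u; have := mem_reduced (i - mex (F ++ l)) u'.
  by rewrite -emex subnK // en => -> <-.
rewrite -[l]revK -[l']revK; congr rev.
apply: ltn_sorted_eq; rewrite ?rev_sorted // => x; rewrite !mem_rev.
have := eqi x; rewrite !mem_cat; case xF: (x \in F) => //= _.
by apply/idP/idP => [/sub|/sub']; rewrite mem_minimal_labels /minimal_free /= xF.
Qed.

Import GRing.Theory.
Local Open Scope ring_scope.

(** Telescoping up to [label_bound n F] covers every first pick: no minimal label lies beyond, and
    the remaining count vanishes by [count_tilings_gap]. *)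
Lemma count_tilings_terms N : (label_bound n F <= N)%N ->
  (count_tilings n N (mem F) 0)%:Z =
  \sum_(p <- terms) (-1) ^+ p.1 * (count_tilings n N (add_labels (mem F) p.2) 0)%:Z.
Proof.
move=> leBN; have bF : bounded N (mem F).
  by move=> x /(mem_label_bound n); lia.
have M0 := minimal_free0 n_gt0 frF.
have B0 : (0 < label_bound n F)%N by rewrite /label_bound; lia.
rewrite (@count_tilings_telescope n n_gt0 N _ 0 (label_bound n F)) // add0n.
have -> : count_tilings n N (mem F) (label_bound n F) = 0%N.
  rewrite -(prednK B0); apply: (count_tilings_gap n_gt0 dcF bF M0) => //; first lia.
  by move=> j ltj _; apply/negP => /minimal_free_bound; lia.
rewrite add0n raddf_sum /terms /recurrence_terms big_allpairs_dep /=.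
apply: eq_big_seq => u; rewrite mem_filter mem_iota => /andP[Mu /= ltuB].
rewrite (@count_tilings_expansion n n_gt0 N (label_bound n F)) //; try lia.
  by apply: bounded_add => //; lia.
exact: connected_pick.
Qed.

Lemma terms_state e l : (e, l) \in terms -> front_state n (reduced (F ++ l)).
Proof.
move=> el; have [_ sub _ con] := terms_mem el.
have eqS : add_labels (mem F) l =1 mem (F ++ l).
  by move=> i; rewrite add_labelsE /= mem_cat orbC.
exact: reduced_state n_gt0 _ (terms_word_uniq el) (word_down_closed sub) (connected_ext eqS con).
Qed.

Lemma count_tilings_term e l k : (e, l) \in terms -> (label_bound n F <= k)%N ->
  (n <= k)%N -> (label_bound n (reduced (F ++ l)) <= k - n)%N ->
  count_tilings n (k + size F) (add_labels (mem F) l) 0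
  = num_tilings n (reduced (F ++ l)) (k - size l).
Proof.
move=> el leBk lenk leb.
have [_ sub _ con] := terms_mem el; have u := terms_word_uniq el.
have /andP[_ lesz] := terms_size el; have fr := terms_state el.
have eqS : add_labels (mem F) l =1 mem (F ++ l).
  by move=> i; rewrite add_labelsE /= mem_cat orbC.
have bw i : i \in F ++ l -> (i < k + size F)%N.
  rewrite mem_cat => /orP[/(mem_label_bound n)|/sub]; first lia.
  by rewrite mem_minimal_labels => /minimal_free_bound; lia.
have [Km nKm] := mexP (F ++ l).
have lemex : (mex (F ++ l) <= k + size F)%N.
  by rewrite leqNgt; apply/negP => /Km /bw; rewrite ltnn.
have := size_reduced u; rewrite size_cat => esz.
(* Shifting by [mex] leaves exactly the strip in which [num_tilings] places the reduced sequence. *)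
have eN : (k + size F - mex (F ++ l) = k - size l + size (reduced (F ++ l)))%N by lia.
rewrite num_tilingsE //; last lia.
rewrite -eN -{1}(subnK lemex) count_tilings_shift //.
- apply: count_tilings_ext => i; rewrite /shift_labels (eqS (i + _)%N) /=.
  by rewrite mem_reduced.
- apply: (down_closed_ext (S := mem (F ++ l))); first by move=> i; rewrite eqS.
  exact: word_down_closed.
- by rewrite subnK // => i; rewrite eqS; apply: bw.
- by move=> i /Km; rewrite eqS.
Qed.

Lemma num_tilings_terms k : (label_bound n F <= k)%N -> (n <= k)%N ->
  (forall p, p \in terms -> (label_bound n (reduced (F ++ p.2)) <= k - n)%N) ->
  (num_tilings n F k)%:Z =
  \sum_(p <- terms) (-1) ^+ p.1 * (num_tilings n (reduced (F ++ p.2)) (k - size p.2))%:Z.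
Proof.
move=> leBk lenk leb; rewrite num_tilingsE //; last lia.
rewrite count_tilings_terms; last lia.
apply: eq_big_seq => -[e l] el; congr (_ * Posz _).
by apply: count_tilings_term el leBk lenk (leb _ el).
Qed.

End State.

End Recurrence.

(** * Enumeration by permutations *)

Section Enumeration.

Variable n : nat.
Hypothesis n_gt0 : 0 < n.
Implicit Types (F s t f : seq nat).

(** For [r < n] not congruent to [m], the only number strictly between [m] and [m + n] with residue
    [r]. *)
Definition next_label m r := m + (r + (n - m %% n)) %% n.

Lemma next_labelP m r : r < n -> r != m %% n ->
  (m < next_label m r < m + n) && (next_label m r %% n == r).
Proof.
move=> ltr ner; rewrite /next_label.
have ltm := ltn_pmod m n_gt0.
have em : (m + (r + (n - m %% n)) %% n) %% n = r.
  rewrite modnDmr -modnDml addnCA subnKC ?(ltnW ltm) //.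
  by rewrite modnDr modn_small.
rewrite em eqxx andbT ltn_add2l ltn_pmod // andbT -[X in X < _]addn0 ltn_add2l lt0n.
by apply: contra ner => /eqP e; move: em; rewrite e addn0 => ->.
Qed.

Lemma next_label_modn x y : x < y < x + n -> next_label x (y %% n) = y.
Proof.
move=> /andP[ltxy lty]; rewrite /next_label.
have ltm := ltn_pmod x n_gt0; have e := divn_eq x n.
suff -> : (y %% n + (n - x %% n)) %% n = y - x by rewrite subnKC // ltnW.
rewrite modnDml; have -> : y + (n - x %% n) = (x %/ n).+1 * n + (y - x).
  by rewrite mulSnr; lia.
by rewrite modnMDl modn_small //; lia.
Qed.

(** Decodes a word of residues into the ascending list of minimal labels, starting from 0. *)
Definition front_of s := 0 :: scanl next_label 0 s.

Lemma scanl_next_label x s : uniq (x %% n :: s) -> all (gtn n) s ->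
  path (fun u v => u < v < u + n) x (scanl next_label x s)
  /\ map (modn^~ n) (scanl next_label x s) = s.
Proof.
elim: s x => //= r s IH x /and3P[nx nr us] /andP[ltr al].
have ner : r != x %% n by apply: contra nx => /eqP->; apply: mem_head.
have /andP[-> /eqP er] := next_labelP ltr ner.
by have [|-> ->] := IH (next_label x r) _ al; rewrite /= er ?nr.
Qed.

Lemma scanl_map_modn x t : path (fun u v => u < v < u + n) x t ->
  scanl next_label x (map (modn^~ n) t) = t.
Proof. by elim: t x => //= y t IH x /andP[lt pt]; rewrite next_label_modn // IH. Qed.

Definition residue_order s := perm_eq s (iota 1 n.-1).

(** The chosen labels are those below the minimal label of their residue class; the maximum bounds
    the search. *)
Definition state_of s :=
  [seq x <- iota 0 (\max_(m <- front_of s) m)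
     | has (fun m => (x < m) && (x == m %[mod n])) (front_of s)].

Section Front.

Variable s : seq nat.
Hypothesis ps : residue_order s.

Lemma front_of_modn : map (modn^~ n) (front_of s) = 0 :: s
  /\ path (fun u v => u < v < u + n) 0 (scanl next_label 0 s).
Proof.
have us : uniq s by rewrite (perm_uniq ps) iota_uniq.
have [||pth em] := @scanl_next_label 0 s; last by rewrite /= em mod0n.
  by rewrite /= mod0n us andbT (perm_mem ps) mem_iota.
by apply/allP => r; rewrite (perm_mem ps) mem_iota /=; lia.
Qed.

Lemma front_of_sorted : sorted ltn (front_of s).
Proof. by have [_ pth] := front_of_modn; apply: sub_path pth => u v /andP[]. Qed.

Lemma front_of_inj m m' : m \in front_of s -> m' \in front_of s ->
  m = m' %[mod n] -> m = m'.
Proof.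
apply: (uniq_map_injective (f := modn^~ n)); have [-> _] := front_of_modn.
by rewrite /= (perm_mem ps) (perm_uniq ps) iota_uniq mem_iota.
Qed.

Lemma front_of_residue x : exists2 m, m \in front_of s & x = m %[mod n].
Proof.
have : x %% n \in map (modn^~ n) (front_of s).
  have [-> _] := front_of_modn; rewrite in_cons (perm_mem ps) mem_iota.
  by have := ltn_pmod x n_gt0; lia.
by case/mapP=> m mf e; exists m.
Qed.

Lemma mem_state_of x : reflect (exists2 m, m \in front_of s & x < m /\ x = m %[mod n])
  (x \in state_of s).
Proof.
apply: (iffP idP) => [|[m mf [ltm e]]].
  by rewrite mem_filter => /andP[/hasP[m mf /andP[lt /eqP e]] _]; exists m.
rewrite mem_filter mem_iota leq0n add0n; apply/andP; split.
  by apply/hasP; exists m; rewrite // ltm e eqxx.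
exact: leq_trans ltm (@leq_bigmax_seq _ _ predT id m mf isT).
Qed.

Lemma state_of_minimal x : minimal_free n (mem (state_of s)) x = (x \in front_of s).
Proof.
apply/idP/idP => [/andP[nx ox]|xf].
  have [m mf e] := front_of_residue x.
  have lemx : m <= x.
    by rewrite leqNgt; apply: contra nx => lt; apply/mem_state_of; exists m.
  move: lemx; rewrite leq_eqVlt => /orP[/eqP <- //|ltmx].
  have /dvdnP[k ek] : n %| x - m by rewrite -eqn_mod_dvd ?(ltnW ltmx) //; apply/eqP.
  case: k ek => [|k]; rewrite ?mul0n ?mulSn => ek; first lia.
  move: ox; have -> /= : x < n = false by lia.
  case/mem_state_of=> m' m'f [lt e'].
  have em : m' = m.
    apply: front_of_inj => //; rewrite -e -e' -[in RHS](@subnK n x); last lia.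
    by rewrite modnDr.
  by move: lt; rewrite em; lia.
apply/andP; split.
  by apply/mem_state_of => -[m' m'f [lt e]]; move: lt; rewrite (front_of_inj xf m'f e) ltnn.
case: (ltnP x n) => //= le; apply/mem_state_of; exists x => //; split; first lia.
by rewrite -[in RHS](subnK le) modnDr.
Qed.

Lemma state_of_front : front_state n (state_of s).
Proof.
split.
- by apply: sorted_filter; [apply: ltn_trans|apply: iota_ltn_sorted].
- apply/mem_state_of => -[m mf [lt e]]; move: lt.
  by rewrite -(front_of_inj (mem_head _ _) mf e).
- move=> i /mem_state_of[m mf [lt e]]; apply/mem_state_of; exists m => //; split; first lia.
  by rewrite -e modnDr.
move=> x; rewrite state_of_minimal => xf [y]; rewrite state_of_minimal => yf lty.
have [i lti ei] := nthP 0 xf; have [j ltj ej] := nthP 0 yf.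
have mono := sorted_leq_nth leq_trans leqnn 0 (sub_sorted ltnW front_of_sorted).
have ltij : i < j.
  by rewrite ltnNge; apply/negP => le; have := mono j i ltj lti le; rewrite ei ej leqNgt lty.
have [_ pth] := front_of_modn; have lt1 : i.+1 < size (front_of s) := leq_ltn_trans ltij ltj.
exists (nth 0 (front_of s) i.+1); first by rewrite state_of_minimal mem_nth.
by rewrite -{1 2}ei; apply: (sortedP 0 (pth : sorted _ (front_of s))).
Qed.

Lemma minimal_labels_state_of : minimal_labels n (state_of s) = front_of s.
Proof.
apply: ltn_sorted_eq; [exact: minimal_labels_sorted|exact: front_of_sorted|].
by move=> x; rewrite mem_minimal_labels state_of_minimal.
Qed.

End Front.

Lemma state_of_inj s s' : residue_order s -> residue_order s' ->
  state_of s = state_of s' -> s = s'.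
Proof.
move=> ps ps' e; have := minimal_labels_state_of ps.
rewrite e minimal_labels_state_of // => /(congr1 (map (modn^~ n))).
by have [-> _] := front_of_modn ps; have [-> _] := front_of_modn ps'; case.
Qed.

(** The word consists of the residues of the minimal labels after 0; gaps less than [n] let
    [next_label] recover those labels. *)
Lemma exists_state_of F : front_state n F -> exists2 s, residue_order s & state_of s = F.
Proof.
move=> frF; have [sF _ dcF _] := frF.
have eM := minimal_labels_behead n_gt0 frF; set t := behead _ in eM.
have gaps := minimal_labels_gaps frF; rewrite eM /= in gaps.
have prm := minimal_labels_perm n_gt0 dcF.
have pt : residue_order (map (modn^~ n) t).
  move: prm; rewrite eM /= mod0n /residue_order.
  by rewrite -[in X in iota 0 X](prednK n_gt0) /= perm_cons.
exists (map (modn^~ n) t) => //.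
have ef : front_of (map (modn^~ n) t) = minimal_labels n F.
  by rewrite /front_of scanl_map_modn // eM.
apply: ltn_sorted_eq; [by have [] := state_of_front pt|exact: sF|].
move=> x; apply/idP/idP => [/(mem_state_of _ _)|xF]; last first.
  by apply/(mem_state_of _ _); rewrite ef; apply: exists_minimal_above.
rewrite ef => -[m mM [lt e]].
have /dvdnP[k ek] : n %| m - x by rewrite -eqn_mod_dvd ?(ltnW lt) //; apply/eqP.
case: k ek => [|k]; rewrite ?mul0n ?mulSnr => ek; first lia.
move: mM; rewrite mem_minimal_labels => /andP[_ /orP[|mF]]; first lia.
apply: (@down_closed_iter n (mem F) k) => //.
by have -> : x + k * n = m - n by lia.
Qed.

Definition length_lex_le : rel (seq nat) := fun F G => (F == G) || length_lex_lt F G.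

Lemma length_lex_lt_trans : transitive length_lex_lt.
Proof.
move=> F G H; rewrite /length_lex_lt.
case/orP=> [lt|/andP[/eqP e1 lt]] /orP[lt'|/andP[/eqP e2 lt']].
- by rewrite (ltn_trans lt).
- by rewrite -e2 lt.
- by rewrite e1 lt'.
- by rewrite e1 e2 eqxx (Order.POrderTheory.lt_trans lt lt') orbT.
Qed.

Lemma length_lex_le_total : total length_lex_le.
Proof.
move=> F G; rewrite /length_lex_le /length_lex_lt; case: (ltngtP (size F) (size G)) => _ /=;
  rewrite ?orbT //.
case: (eqVneq F G) => //= ne.
by rewrite -Order.TotalTheory.neq_lt.
Qed.

Definition fundamental_sequences : seq (seq nat) :=
  sort length_lex_le (map state_of (permutations (iota 1 n.-1))).

Lemma fundamental_sequencesP F : F \in fundamental_sequences <-> fundamental n F.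
Proof.
rewrite fundamentalP // mem_sort; split=> [/mapP[s]|/exists_state_of[s ps <-]].
  by rewrite mem_permutations => ps ->; apply: state_of_front.
by apply: map_f; rewrite mem_permutations.
Qed.

Lemma fundamental_sequences_uniq : uniq fundamental_sequences.
Proof.
rewrite sort_uniq map_inj_in_uniq ?permutations_uniq // => s s'.
by rewrite !mem_permutations; apply: state_of_inj.
Qed.

Lemma size_fundamental_sequences : size fundamental_sequences = (n.-1)`!.
Proof. by rewrite size_sort size_map size_permutations ?iota_uniq // size_iota. Qed.

Lemma fundamental_sequences_sorted : sorted length_lex_lt fundamental_sequences.
Proof.
have le_trans : transitive length_lex_le.
  move=> F G H; rewrite /length_lex_le => /predU1P[->|lt] /predU1P[<-|lt'];
    rewrite ?eqxx ?lt ?lt' ?orbT //.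
  by rewrite (length_lex_lt_trans lt lt') orbT.
have := sort_sorted length_lex_le_total (map state_of (permutations (iota 1 n.-1))).
rewrite -/fundamental_sequences; have := fundamental_sequences_uniq.
rewrite (sorted_pairwise le_trans) (sorted_pairwise length_lex_lt_trans) uniq_pairwise.
elim: fundamental_sequences => //= F Fs IH /andP[ne u] /andP[le sle]; rewrite IH // andbT.
apply/allP => G GFs; have /orP[/eqP e|//] := allP le G GFs.
by have := allP ne G GFs; rewrite /= e eqxx.
Qed.

End Enumeration.

(** * The matrix *)

Import GRing.Theory.
Local Open Scope ring_scope.

Section BlockMatrix.

Variables q r m : nat.
Variables (e1 : (q + r = m)%N) (e2 : (r + q = m)%N) (A : 'M[int]_(q, r)).

Let B : 'M_m := castmx (e1, e2) (block_mx A 1%:M 1%:M 0).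

Lemma cast_blockE i j : B i j =
  match split (cast_ord (esym e1) i), split (cast_ord (esym e2) j) with
  | inl i, inl j => A i j
  | inl i, inr j => (i == j)%:R
  | inr i, inl j => (i == j)%:R
  | inr _, inr _ => 0
  end.
Proof.
rewrite castmxE /=; move: (cast_ord _ i) (cast_ord _ j) => {i j} i j.
case: (split_ordP i) => i' ->; case: (split_ordP j) => j' ->.
- by rewrite block_mxEul.
- by rewrite block_mxEur mxE.
- by rewrite block_mxEdl mxE.
- by rewrite block_mxEdr mxE.
Qed.

Lemma cast_block_mulE (v : 'cV_m) i : (B *m v) i 0 =
  match split (cast_ord (esym e1) i) with
  | inl i => \sum_c A i c * v (cast_ord e2 (lshift q c)) 0
             + v (cast_ord e2 (rshift r i)) 0
  | inr i => v (cast_ord e2 (lshift q i)) 0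
  end.
Proof.
rewrite mxE (reindex (cast_ord e2)) /=; last first.
  by exists (cast_ord (esym e2)) => j _; rewrite ?cast_ordK ?cast_ordKV.
rewrite big_split_ord /=.
under eq_bigr => j _ do rewrite cast_blockE cast_ordK (unsplitK (inl _ j)).
under [X in _ + X]eq_bigr => j _ do rewrite cast_blockE cast_ordK (unsplitK (inr _ j)).
case: (split _) => i'.
  congr (_ + _); rewrite (bigD1 i') //= eqxx mul1r big1 ?addr0 // => j nej.
  by rewrite eq_sym (negbTE nej) mul0r.
rewrite [X in _ + X]big1 ?addr0 => [|j _]; last by rewrite mul0r.
rewrite (bigD1 i') //= eqxx mul1r big1 ?addr0 // => j nej.
by rewrite eq_sym (negbTE nej) mul0r.
Qed.

End BlockMatrix.

(** * Entries of the upper left block and the scalar recurrence *)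

Section Coefficients.

Variable n : nat.
Hypothesis n_gt1 : (1 < n)%N.

Let n_gt0 : (0 < n)%N := ltnW n_gt1.
Let q := (n.-1)`!.
Let q_gt0 : (0 < q)%N := fact_gt0 _.
Let Fs := fundamental_sequences n.
Let F i := nth [::] Fs i.

(** Column [c] stands for the count of [F (c %% q)] at [N.-1 - c %/ q]. A term that removes
    [size p.2] labels lowers the argument [N] by that amount, whence the successor. *)
Definition term_column i c (p : bool * seq nat) :=
  ((c %/ q).+1 == size p.2) && (F (c %% q) == reduced (F i ++ p.2)).

Definition coefficients : 'M[int]_(q, n.-1 * q) :=
  \matrix_(i, c) \sum_(p <- terms n (F i) | term_column i c p) (-1) ^+ p.1.

Lemma nth_front_state i : (i < q)%N -> front_state n (F i).
Proof.
move=> lti; apply/fundamentalP => //; apply/fundamental_sequencesP => //.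
by apply: mem_nth; rewrite size_fundamental_sequences.
Qed.

(** By [terms_reduced_inj] at most one term contributes to each entry. *)
Lemma coefficientsP i c : coefficients i c \in [:: 0; 1; -1].
Proof.
have frF := nth_front_state (ltn_ord i); rewrite mxE -big_filter.
have : (size [seq p <- terms n (F i) | term_column i c p] <= 1)%N.
  have := map_uniq (terms_uniq n (F i)).
  move/(filter_uniq (term_column i c)); set s := [seq _ <- _ | _].
  have sub p : p \in s -> term_column i c p && (p \in terms n (F i)) by rewrite mem_filter.
  case: s sub => [|[e l] [|[e' l'] s]] //= sub;
    rewrite in_cons negb_or => /andP[/andP[/negP ne _] _].
  have /andP[/andP[/eqP /= s1 /eqP n1] t1] := sub _ (mem_head _ _).
  have /andP[/andP[/eqP /= s2 /eqP n2] t2] : term_column i c (e', l') && ((e', l') \in terms n (F i)).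
    by apply: sub; rewrite !in_cons eqxx orbT.
  by case: ne; apply/eqP/(terms_reduced_inj n_gt0 frF t1 t2); [rewrite -s1 -s2|rewrite -n1 -n2].
case: [seq _ <- _ | _] => [|[e l] [|//]] _; first by rewrite big_nil.
by rewrite big_seq1; case: e.
Qed.

Lemma coefficients_recurrence : exists N0, forall N (i : 'I_q), (N0 <= N)%N ->
  (num_tilings n (F i) N)%:Z =
  \sum_c coefficients i c * (num_tilings n (F (c %% q)) (N.-1 - c %/ q))%:Z
  + (num_tilings n (F i) (N - n))%:Z.
Proof.
have szF := size_fundamental_sequences n.
(* Terms lower the argument by up to [n], so [N - n] must still be at least every [label_bound]. *)
exists (n + \max_(G <- Fs) label_bound n G)%N => N i leN.
have frF := nth_front_state (ltn_ord i).
have bnd G : front_state n G -> (label_bound n G <= N - n)%N.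
  move=> frG; have GF : G \in Fs by apply/fundamental_sequencesP => //; apply/fundamentalP.
  rewrite leq_subRL; last by lia.
  apply: leq_trans leN; rewrite leq_add2l.
  exact: (@leq_bigmax_seq _ _ predT (label_bound n) G GF isT).
rewrite num_tilings_terms //; first last.
- by move=> [e l] el; apply/bnd/(terms_state n_gt0 frF el).
- lia.
- by have := bnd _ frF; lia.
pose g c := (num_tilings n (F (c %% q)) (N.-1 - c %/ q))%:Z.
pose full := (false, rev (minimal_labels n (F i))).
have fullP := terms_all n_gt0 frF; have ut := map_uniq (terms_uniq n (F i)).
have szfull : size (minimal_labels n (F i)) = n.
  by have [_ _ dc _] := frF; apply: size_minimal_labels.
(* The term of all minimal labels reduces to [F i] itself at argument [N - n]: this is the
   contribution of [I_2]. *)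
rewrite (bigD1_seq full) //= expr0 mul1r size_rev szfull.
rewrite -/(state_word n (F i)) state_word_reduced // addrC; congr (_ + _).
transitivity (\sum_(p <- terms n (F i)) \sum_(c < n.-1 * q | term_column i c p) (-1) ^+ p.1 * g c);
    last first.
  rewrite (exchange_big_dep xpredT) //=; apply: eq_bigr => c _; rewrite mxE mulr_suml.
  exact: eq_bigr.
(* The full term has [n] labels and so belongs to no column of this block. *)
rewrite [RHS](bigD1_seq full) //= [X in _ = X + _]big_pred0 ?add0r => [|c]; last first.
  apply/negbTE; rewrite /term_column /= size_rev szfull negb_and; apply/orP; left.
  have := ltn_ord c; rewrite -ltn_divLR //; lia.
rewrite big_seq_cond [RHS]big_seq_cond; apply: eq_bigr => -[e l] /andP[el nef].
have /andP[sz0 szn] := terms_size n_gt0 frF el.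
have ltsz : (size l < n)%N.
  rewrite ltn_neqAle szn andbT; apply: contra nef => /eqP sz.
  by rewrite (terms_full n_gt0 frF el sz).
have GF : reduced (F i ++ l) \in Fs.
  by apply/fundamental_sequencesP => //; apply/fundamentalP => //; apply: terms_state el.
have ltx : (index (reduced (F i ++ l)) Fs < q)%N by move: GF; rewrite -index_mem szF.
have ltc : ((size l).-1 * q + index (reduced (F i ++ l)) Fs < n.-1 * q)%N.
  have : ((size l).-1.+1 * q <= n.-1 * q)%N by rewrite leq_mul2r; apply/orP; right; lia.
  rewrite mulSnr; lia.
(* Every other term belongs to exactly one column, determined by its size and its reduced
   sequence. *)
rewrite (big_pred1 (Ordinal ltc)) => [|c].
  rewrite /g /= divnMDl // modnMDl (divn_small ltx) (modn_small ltx) addn0.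
  by rewrite /F nth_index //; congr (_ * Posz (num_tilings _ _ _)); lia.
rewrite /term_column /=; apply/andP/eqP => [[/eqP e1 /eqP e2]|-> /=].
  apply: val_inj; rewrite /= -e1 -e2 /= /F index_uniq ?fundamental_sequences_uniq //.
    exact: divn_eq.
  by rewrite szF ltn_mod.
rewrite divnMDl // modnMDl (divn_small ltx) (modn_small ltx) addn0 /F nth_index //.
by rewrite prednK.
Qed.

End Coefficients.

Theorem theorem3 (n : nat) (n_gt1 : (1 < n)%N) :
  exists Fs : seq (seq nat),
    [/\ sorted length_lex_lt Fs,
        forall F : seq nat, F \in Fs <-> fundamental n F,
        size Fs = (n.-1)`! :> nat
      & exists A : 'M[int]_(n`!),
          [/\ exists N0 : nat, forall N : nat, (N0 <= N)%N ->
                f_vec n Fs N = A *m f_vec n Fs N.-1,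
              forall i j : 'I_(n`!), A i j \in [:: 0; 1; -1]
            & exists A' : 'M[int]_((n.-1)`!, (n.-1 * (n.-1)`!)%N),
                A = castmx (fact_row_split n_gt1, fact_col_split n_gt1)
                      (block_mx A' 1%:M 1%:M 0)]].
Proof.
have n_gt0 := ltnW n_gt1; exists (fundamental_sequences n); split.
- exact: fundamental_sequences_sorted.
- by move=> F; apply: fundamental_sequencesP.
- exact: size_fundamental_sequences.
exists (castmx (fact_row_split n_gt1, fact_col_split n_gt1)
  (block_mx (coefficients n) 1%:M 1%:M 0)); split; last by exists (coefficients n).
- have [N0 rec] := coefficients_recurrence n_gt1.
  exists (maxn N0 n) => N; rewrite geq_max => /andP[leN0 len].
  apply/matrixP => i j; rewrite [j]ord1 cast_block_mulE mxE.
  have ei : (i : nat) = cast_ord (esym (fact_row_split n_gt1)) i by [].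
  case: (split_ordP (cast_ord (esym (fact_row_split n_gt1)) i)) => i' e; rewrite e in ei *.
    (* The rows with [j = 0] carry the recurrence. *)
    rewrite ei /= modn_small // divn_small // subn0 rec //.
    congr (_ + _); first by apply: eq_bigr => c _; congr (_ * _); rewrite mxE.
    rewrite mxE /= modnMDl divnMDl ?fact_gt0 // modn_small // divn_small //.
    by congr (Posz (num_tilings _ _ _)); lia.
  (* In the lower rows [N - (j + 1)] equals [(N - 1) - j], so [I_1] copies the entry. *)
  rewrite mxE ei /= -[X in (X + i')%N]mul1n modnMDl divnMDl ?fact_gt0 //.
  by congr (Posz (num_tilings _ _ _)); lia.
move=> i j; rewrite cast_blockE.
case: (split _) => i'; case: (split _) => j'; first exact: coefficientsP.
- by case: (i' == j').
- by case: (i' == j').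
- by [].
Qed.
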